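(* Let $\eta\ge2$ be an integer, let $m\ge2$ be an integer, let $w$ be a $\mathcal C_0^m([0,1])$ weighting function, let $\mathtt d,\tilde\Delta_\infty$ be approximation functions, let $\gamma>0$, let $f\in\mathcal B_{\tilde\Delta_\infty}$, and let $\rho\in\mathbb T^\infty$ satisfy the infinite-dimensional nonresonant condition with data $(\gamma,\mathtt d)$ (in the discrete sense (c) for the first estimate, in the continuous sense (d) for the second estimate). Assume $$\sum_{0\ne k\in\mathbb Z_*^\infty}\frac{\mathtt d^m(|k|_\eta)}{\tilde\Delta_\infty(|k|_\eta)}<+\infty .$$ Then there is a constant $C_2>0$, depending only on $f,\mathtt d,\tilde\Delta_\infty,\eta,w,\gamma,m$ (in particular not on $\theta,N,T$), such that for all $\theta\in\mathbb T^\infty$: (discrete case) if $\rho$ satisfies (c), then $$\left\|\mathrm{WB}_N(f)(\theta)-\int_{\mathbb T^\infty}f(\hat\theta)\,d\hat\theta\right\|_{\mathcal B}\le\frac{C_2}{N^m}\quad\text{for all integers } N\ge2;$$ (continuous case) if $\rho$ satisfies (d), then $$\left\|\frac1T\int_0^T w(t/T)\,f(\rho t+\theta)\,dt-\int_{\mathbb T^\infty}f(\hat\theta)\,d\hat\theta\right\|_{\mathcal B}\le\frac{C_2}{T^m}\quad\text{for all real } T\ge1.$$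
   Context: An approximation function is a continuous, strictly increasing function $\Delta:[1,+\infty)\to[1,+\infty)$ with $\Delta(+\infty)=+\infty$. $\mathtt d^m(x)$ means $(\mathtt d(x))^m$. $\mathbb N=\{0,1,2,\dots\}$, $\mathbb T^\infty=\mathbb T^{\mathbb N}$ with the product (normalized Lebesgue) probability measure; the set of rotation vectors $\rho$ is identified with the cube $[1,2]^{\mathbb N}$. For a fixed integer $\eta\ge2$, $$\mathbb Z_*^\infty=\Big\{k\in\mathbb Z^{\mathbb N}:\ |k|_\eta:=\sum_{j\in\mathbb N}\langle j\rangle^\eta|k_j|<+\infty\Big\},\qquad \langle j\rangle=\max\{1,|j|\},$$ so each such $k$ has finite support. The irrational vector $\rho\in\mathbb T^\infty$ satisfies the infinite-dimensional nonresonant condition with data $\gamma>0$ and approximation function $\mathtt d$ if (c) (discrete case) $|k\cdot\rho-n|>\gamma/\mathtt d(|k|_\eta)$ for all $0\ne k\in\mathbb Z_*^\infty$ and all $n\in\mathbb Z$; (d) (continuous case) $|k\cdot\rho|>\gamma/\mathtt d(|k|_\eta)$ for all $0\ne k\in\mathbb Z_*^\infty$. $(\mathcal B,\|\cdot\|_{\mathcal B})$ is a Banach (function) space, possibly infinite-dimensional, over complex scalars. For an approximation function $\tilde\Delta_\infty$, $\mathcal B_{\tilde\Delta_\infty}$ is the set of $f:\mathbb T^\infty\to\mathcal B$ such that $f(\theta)=\sum_{k\in\mathbb Z_*^\infty}\hat f_k e^{2\pi i k\cdot\theta}$ for every $\theta$ (equality in the norm of $\mathcal B$), where $\hat f_k=\int_{\mathbb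 T^\infty}f(\hat\theta)e^{-2\pi i k\cdot\hat\theta}\,d\hat\theta$, and $\sup_{0\ne k\in\mathbb Z_*^\infty}\tilde\Delta_\infty(|k|_\eta)\,\|\hat f_k\|_{\mathcal B}<+\infty$. A $\mathcal C_0^m([0,1])$ weighting function is $w\in C^\infty([0,1])$ with $w^{(k)}(0)=w^{(k)}(1)=0$ for all $0\le k\le m$, $w(x)>0$ for $x\in(0,1)$, and $\int_0^1 w(s)\,ds=1$. With $T_\rho(\theta)=\theta+\rho \bmod 1$ in each coordinate, the weighted Birkhoff average is $$\mathrm{WB}_N(f)(\theta)=\frac1{A_N}\sum_{n=0}^{N-1}w\!\left(\frac nN\right)f(T_\rho^n(\theta)),\qquad A_N=\sum_{n=0}^{N-1}w\!\left(\frac nN\right).$$ *)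

(* Defs.v *)
From HB Require Import structures.
From mathcomp Require Import all_boot all_order all_algebra finmap complex.
From mathcomp Require Import all_classical all_reals all_analysis.
From mathcomp Require Import showcase.summability.

Set Implicit Arguments.
Unset Strict Implicit.
Unset Printing Implicit Defensive.

Import Order.TTheory GRing.Theory Num.Theory.
Import numFieldNormedType.Exports.

Local Open Scope classical_set_scope.
Local Open Scope ring_scope.
Local Open Scope complex_scope.

Section Bochner.
Context {R : realType} {B : normedModType R[i]}.

(* The norm of a normed module over R[i] is R[i]-valued, with zero imaginary
   part. *)
Definition rnorm (v : B) : R := complex.Re `|v|.

Context {dT : measure_display} {T : measurableType dT}.
Variables (mu : {measure set T -> \bar R}) (D : set T).

Definition simple_fun (s : T -> B) : Prop :=
  [/\ finite_set (s @` D),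
      forall v, measurable (D `&` s @^-1` [set v]) &
      forall v, v != 0 -> (mu (D `&` s @^-1` [set v]) < +oo)%E].

(* For v = 0 the measure may be infinite, but the term vanishes. *)
Definition simple_integral (s : T -> B) : B :=
  \sum_(v \in s @` D) (fine (mu (D `&` s @^-1` [set v])))%:C *: v.

(* Strong measurability of f is the a.e. convergence of the s n. It makes
   rnorm (f x - s n x) a.e. equal to a measurable function, so that its integral
   has the usual meaning. *)
Definition is_bochner_integral (f : T -> B) (I : B) : Prop :=
  exists s : nat -> T -> B,
    [/\ forall n, simple_fun (s n),
        {ae mu, forall x, D x -> s n x @[n --> \oo] --> f x},
        (\int[mu]_(x in D) (rnorm (f x - s n x))%:E)%E @[n --> \oo] --> 0%E &
        simple_integral (s n) @[n --> \oo] --> I].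

Definition bochner_integrable (f : T -> B) : Prop :=
  exists I, is_bochner_integral f I.

Definition bochner_integral (f : T -> B) : B :=
  xget 0 [set I | is_bochner_integral f I].

End Bochner.

Section Torus.
Context {R : realType}.

(* R/Z through its fundamental domain [0, 1[. *)
Definition circle : Type := {x : R | 0 <= x < 1}.

HB.instance Definition _ := Choice.on circle.

Definition frac (x : R) : R := x - (Num.floor x)%:~R.

Lemma frac_itv (x : R) : 0 <= frac x < 1.
Proof.
rewrite /frac subr_ge0 floor_le /= ltrBlDr addrC.
by rewrite -(intrD _ _ 1) floorD1_gt.
Qed.

Definition to_circle (x : R) : circle := exist _ (frac x) (frac_itv x).

HB.instance Definition _ := isPointed.Build circle (to_circle 0).

Definition coord_preimages : set (set (nat -> circle)) :=
  [set A | exists j : nat, exists2 C : set R,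
     measurable C & A = [set theta | C (val (theta j))]].

End Torus.
Arguments circle R : clear implicits.

(* T^N with its product sigma-algebra. *)
Notation torus R := (g_sigma_algebraType (@coord_preimages R)).

Section Defs.
Context {R : realType}.

(* The cylinders form a pi-system generating the sigma-algebra, so these values
   single out the normalized product Lebesgue measure. *)
Definition is_product_lebesgue (mu : probability (torus R) R) : Prop :=
  forall (n : nat) (C : nat -> set R), (forall j, measurable (C j)) ->
    mu [set theta : torus R | forall j, (j < n)%N -> C j (val (theta j))] =
    (\prod_(j < n) lebesgue_measure (C j `&` [set x : R | (0 <= x < 1)%R]))%E.

Definition rotation (rho : nat -> R) (theta : torus R) : torus R :=
  fun j => to_circle (val (theta j) + rho j).

(* theta + rho t mod 1 *)
Definition flow (rho : nat -> R) (t : R) (theta : torus R) : torus R :=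
  rotation (fun j => rho j * t) theta.

Definition approximation_function (h : R -> R) : Prop :=
  [/\ {within `[1, +oo[, continuous h},
      {in `[1, +oo[ &, {homo h : x y / x < y}},
      {in `[1, +oo[, forall x, 1 <= h x} &
      h x @[x --> +oo] --> +oo].

Definition eta_norme (eta : nat) (k : nat -> int) : \bar R :=
  (\sum_(0 <= j <oo) ((maxn 1 j ^ eta * `|k j|%N)%:R)%:E)%E.

Definition eta_norm (eta : nat) (k : nat -> int) : R := fine (eta_norme eta k).

Definition Zstar (eta : nat) : set (nat -> int) :=
  [set k | (eta_norme eta k < +oo)%E].

Definition Zstar_neq0 (eta : nat) : set (nat -> int) :=
  Zstar eta `\ (fun=> 0).

(* All terms but finitely many vanish when k is in Zstar. *)
Definition pairing (k : nat -> int) (x : nat -> R) : R :=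
  \sum_(j \in [set: nat]) (k j)%:~R * x j.

Definition nonresonant_discrete (eta : nat) (gamma : R) (d : R -> R)
    (rho : nat -> R) : Prop :=
  forall k, Zstar_neq0 eta k -> forall n : int,
    `|pairing k rho - n%:~R| > gamma / d (eta_norm eta k).

Definition nonresonant_continuous (eta : nat) (gamma : R) (d : R -> R)
    (rho : nat -> R) : Prop :=
  forall k, Zstar_neq0 eta k -> `|pairing k rho| > gamma / d (eta_norm eta k).

(* e^{2 pi i x} *)
Definition cis2pi (x : R) : R[i] := cos (2 * pi * x) +i* sin (2 * pi * x).

Definition character (k : nat -> int) (theta : torus R) : R[i] :=
  cis2pi (pairing k (fun j => val (theta j))).

Section Banach.
Context {B : completeNormedModType R[i]}.
Variable mu : probability (torus R) R.

Definition torus_integral (f : torus R -> B) : B :=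
  bochner_integral mu [set: torus R] f.

Definition fourier_coef (f : torus R -> B) (k : nat -> int) : B :=
  torus_integral (fun theta => character (fun j => - k j) theta *: f theta).

(* The Fourier series is summed unconditionally, along the finite subsets of
   Zstar. *)
Definition in_BDelta (eta : nat) (Delta : R -> R) (f : torus R -> B) : Prop :=
  [/\ bochner_integrable mu [set: torus R] f,
      forall theta : torus R,
        partial_sum (fun k : Zstar eta =>
          character (val k) theta *: fourier_coef f (val k)) @ totally
        --> f theta &
      (ereal_sup [set (Delta (eta_norm eta k) * rnorm (fourier_coef f k))%:E
                 | k in Zstar_neq0 eta] < +oo)%E].

End Banach.

(* One-sided at the end points of an interval. *)
Definition is_derive_within (A : set R) (f : R -> R) (x l : R) : Prop :=
  (f y - f x) / (y - x) @[y --> within A x^'] --> l.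

(* w n is the n-th derivative of w 0 on [0, 1]. *)
Definition derivatives01 (w : nat -> R -> R) : Prop :=
  forall n x, x \in `[0, 1] -> is_derive_within `[0, 1] (w n) x (w n.+1 x).

Definition weighting_function (m : nat) (w : R -> R) : Prop :=
  [/\ exists dw : nat -> R -> R,
        [/\ dw 0%N = w, derivatives01 dw &
            forall k, (k <= m)%N -> dw k 0 = 0 /\ dw k 1 = 0],
      forall x, x \in `]0, 1[ -> 0 < w x &
      \int[lebesgue_measure]_(x in `[0, 1]) w x = 1].

Section Averages.
Context {B : completeNormedModType R[i]}.
Variables (w : R -> R) (rho : nat -> R) (f : torus R -> B) (theta : torus R).

Definition WB_norm (N : nat) : R := \sum_(0 <= n < N) w (n%:R / N%:R).

Definition WB (N : nat) : B :=
  ((WB_norm N)^-1)%:C *: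
    \sum_(0 <= n < N) (w (n%:R / N%:R))%:C *: f (iter n (rotation rho) theta).

Definition WB_cont (T : R) : B :=
  (T^-1)%:C *: bochner_integral lebesgue_measure `[0, T]
                 (fun t => (w (t / T))%:C *: f (flow rho t theta)).

End Averages.
End Defs.
Arguments Zstar R eta : clear implicits.
Arguments Zstar_neq0 R eta : clear implicits.

(* Main.v *)
Require Import Defs.
From HB Require Import structures.
From mathcomp Require Import all_boot all_order all_algebra finmap complex.
From mathcomp Require Import all_classical all_reals all_analysis.
From mathcomp Require Import measurable_realfun showcase.summability.
From mathcomp Require Import ring lra zify.

Set Implicit Arguments.
Unset Strict Implicit.
Unset Printing Implicit Defensive.

Import Order.TTheory GRing.Theory Num.Theory.
Import numFieldNormedType.Exports.

Local Open Scope classical_set_scope.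
Local Open Scope ring_scope.
Local Open Scope complex_scope.

(** The observable is the sum of its Fourier series and the characters are
    multiplied by a phase along the orbit, so
    [f (flow rho t theta) = sum_k e(t * (k . rho)) u_k], where
    [e(x) = cis2pi x] and [u_k] has the norm of the Fourier coefficient of
    index [k]; moreover [u_0] is the space average. A weighted average of [f]
    minus its space average is therefore the sum over [k != 0] of [u_k] times a
    scalar exponential sum, and two estimates are balanced against each other.

    - Exponential sums ([weight_sum_bound], [weight_sum_small_divisor]). The
      [m]-fold product of [1 - e(a)] with [sum_(n < N) w(n / N) e(n a)] is, by
      summation by parts, the sum of the [m]-th differences of [w] with step
      [1 / N]. The weight vanishes to order [m] at both end points, so its
      extension by zero has [m] derivatives on the line; the differences are
      [O(N ^- m)], no boundary term appears, and the sum is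
      [O(N ^ (1 - m)) / |1 - e(a)| ^ m]. For [a = k . rho] the nonresonance
      condition bounds [|1 - e(a)| ^- m] by [(d(|k|) / gamma) ^ m].
    - Decay ([exp_comb_bound]). The Fourier coefficients are [O(1 / Delta(|k|))]
      and the series of the [d(|k|) ^ m / Delta(|k|)] converges, which absorbs
      the small divisors uniformly in [rho] and [theta].

    In the discrete case ([WB_convergence]) it remains to divide by [A_N], which
    is at least a multiple of [N] because [A_N / N] is a Riemann sum of [w].

    In the continuous case ([WB_cont_convergence]) the integrand is uniformly
    continuous with values in a Banach space, so that its Bochner integral is
    the limit of its Riemann sums ([bochner_integral_riemann]). These are again
    sums of the discrete kind, with [a = T (k . rho) / n]. For a fixed [k] and
    large [n] this number is less than [1 / 2] in absolute value, hence
    [|1 - e(a)| >= 2 |a|], and the powers of [n] cancel. This is not uniform in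
    [k], but all but finitely many frequencies contribute an arbitrarily small
    amount, so one lets [n] tend to infinity for a fixed finite set of
    frequencies and then enlarges the set. *)

(** * Complex modulus and exponentials *)

Section ComplexModulus.
Context {R : realType}.
Implicit Types (z : R[i]) (x y : R).

(** [`|z|] lives in [R[i]]; estimates are carried out with its real part. *)
Definition cabs z : R := complex.Re `|z|.

Lemma normC_cabs z : `|z| = (cabs z)%:C.
Proof. by rewrite /cabs normc_def. Qed.

Lemma cabsE z : cabs z = Num.sqrt (complex.Re z ^+ 2 + complex.Im z ^+ 2).
Proof. by rewrite /cabs normc_def. Qed.

Lemma cabs_ge0 z : 0 <= cabs z.
Proof. by rewrite cabsE sqrtr_ge0. Qed.

Lemma cabsM z z' : cabs (z * z') = cabs z * cabs z'.
Proof. by apply: complexI; rewrite rmorphM -!normC_cabs normrM. Qed.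

Lemma cabsX z n : cabs (z ^+ n) = cabs z ^+ n.
Proof. by apply: complexI; rewrite rmorphXn -!normC_cabs normrX. Qed.

Lemma cabs_real x : cabs x%:C = `|x|.
Proof. by rewrite cabsE /= expr0n addr0 sqrtr_sqr. Qed.

Lemma le_cabs_sum (I : Type) (r : seq I) (P : pred I) (F : I -> R[i]) :
  cabs (\sum_(i <- r | P i) F i) <= \sum_(i <- r | P i) cabs (F i).
Proof.
rewrite -lecR -normC_cabs (le_trans (ler_norm_sum _ _ _))//.
by rewrite rmorph_sum/= ler_sum// => i _; rewrite normC_cabs.
Qed.

Lemma cis2piD x y : cis2pi (x + y) = cis2pi x * cis2pi y.
Proof.
rewrite /cis2pi mulrDr cosD sinD.
by apply/eqP; rewrite eq_complex /= eqxx /= addrC.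
Qed.

Lemma cis2pi0 : cis2pi 0 = 1 :> R[i].
Proof. by rewrite /cis2pi mulr0 cos0 sin0. Qed.

Lemma cis2pi_sum (I : Type) (r : seq I) (F : I -> R) :
  cis2pi (\sum_(i <- r) F i) = \prod_(i <- r) cis2pi (F i).
Proof.
elim: r => [|i r IH]; first by rewrite !big_nil cis2pi0.
by rewrite !big_cons cis2piD IH.
Qed.

Lemma cis2pi_nat x n : cis2pi (n%:R * x) = cis2pi x ^+ n.
Proof.
elim: n => [|n IH]; first by rewrite mul0r cis2pi0 expr0.
by rewrite exprS -IH -cis2piD; congr cis2pi; rewrite -natr1; ring.
Qed.

Lemma cabs_cis2pi x : cabs (cis2pi x) = 1.
Proof. by rewrite cabsE /= cos2Dsin2 sqrtr1. Qed.

Lemma cis2pi_natr n : cis2pi n%:R = 1 :> R[i].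
Proof.
rewrite -[_%:R]mulr1 cis2pi_nat (_ : cis2pi 1 = 1) ?expr1n//.
by rewrite /cis2pi mulr1 mulr_natl cos2pi sin2pi.
Qed.

Lemma cis2pi_int (n : int) : cis2pi n%:~R = 1 :> R[i].
Proof.
case: n => n; first exact: cis2pi_natr.
rewrite NegzE mulrNz -[RHS]cis2pi0 -[in RHS](subrr n.+1%:R) cis2piD.
by rewrite cis2pi_natr mul1r.
Qed.

Lemma cis2piB_int x (n : int) : cis2pi (x - n%:~R) = cis2pi x.
Proof. by rewrite cis2piD -mulrNz cis2pi_int mulr1. Qed.

Lemma cabs_1B_cis2pi x : cabs (1 - cis2pi x) = 2 * `|sin (pi * x)|.
Proof.
rewrite cabsE /= -[2 * pi * x](_ : (pi * x) *+ 2 = _); last by ring.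
rewrite cos_mulr2n sin_mulr2n.
have h : cos (pi * x) ^+ 2 = 1 - sin (pi * x) ^+ 2 by exact: cos2sin2.
set c := cos _ in h *; set s := sin _ in h *.
rewrite [X in Num.sqrt X](_ : _ = (2 * s) ^+ 2); last first.
  transitivity ((1 - (c ^+ 2 *+ 2 - 1)) ^+ 2 + 4 * c ^+ 2 * s ^+ 2); first by ring.
  by rewrite h; ring.
by rewrite sqrtr_sqr normrM ger0_norm.
Qed.

(** By the mean value theorem [sin (y / 2)] is [y / 2] times a value of the
    cosine on [[0, y / 2]], hence at least [y / 2 * cos (y / 2)]; doubling the
    angle and [2 * cos (y / 2) ^+ 2 = 1 + cos y >= 1] conclude. *)
Lemma sin_ge_half y : 0 <= y <= pi / 2 -> y / 2 <= sin y.
Proof.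
move=> /andP[y0 ypi].
have pi0 := pi_ge0 R.
have cy : 0 <= cos y by apply: cos_ge0_pihalf; apply/andP; split; lra.
have h2 : cos (y / 2) ^+ 2 >= 2^-1.
  have := cos_mulr2n (y / 2); rewrite [X in cos X](_ : _ = y); last by field.
  by move=> E; lra.
have [c cin E] : exists2 c, c \in `[0, y / 2]%R &
    sin (y / 2) - sin 0 = cos c * (y / 2 - 0).
  have cs : {within `[0, y / 2], continuous (@sin R)}.
    by apply: continuous_subspaceT; exact: continuous_sin.
  by apply: (MVT_segment _ (fun x _ => is_derive_sin x) cs); lra.
rewrite sin0 !subr0 in E; have cI := itvP cin.
have cc : cos (y / 2) <= cos c.
  have [->//|ne] := eqVneq c (y / 2).
  have clt : c < y / 2 by rewrite lt_neqAle ne cI.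
  have c0 : 0 <= c by rewrite cI.
  by apply/ltW; rewrite ltr_cos// in_itv/=; apply/andP; split; lra.
have c2 : 0 <= cos (y / 2) by apply: cos_ge0_pihalf; apply/andP; split; lra.
rewrite -[X in sin X](_ : (y / 2) *+ 2 = _); last by field.
rewrite sin_mulr2n E.
have : cos (y / 2) * (cos (y / 2) * (y / 2)) <= cos (y / 2) * (cos c * (y / 2)).
  by rewrite ler_wpM2l// ler_wpM2r//; lra.
have : 2^-1 * (y / 2) <= cos (y / 2) ^+ 2 * (y / 2) by rewrite ler_wpM2r//; lra.
rewrite expr2; lra.
Qed.

(** On [[-1/2, 1/2]] the modulus is [2 * |sin (pi x)|], with [|pi x| <= pi / 2],
    and [pi >= 2]. *)
Lemma cabs_1B_cis2pi_ge x : `|x| <= 1 / 2 -> 2 * `|x| <= cabs (1 - cis2pi x).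
Proof.
move=> xh; rewrite cabs_1B_cis2pi ler_pM2l//.
have -> : `|sin (pi * x)| = `|sin (pi * `|x|)|.
  by case: (ger0P x) => // _; rewrite mulrN sinN normrN.
have x0 := normr_ge0 x; set a := `|x| in xh x0 *.
have p2 := pi_ge2 R.
apply: le_trans (ler_norm _).
apply: le_trans (sin_ge_half _).
  by rewrite -[leLHS]mul1r mulrAC ler_wpM2r// ler_pdivlMr// mul1r.
apply/andP; split; first by rewrite mulr_ge0// pi_ge0.
by rewrite ler_wpM2l ?pi_ge0//; move: xh; rewrite mul1r.
Qed.

Lemma near_int x : exists n : int, `|x - n%:~R| <= 1 / 2.
Proof.
exists (Num.floor (x + 1 / 2)).
have := floor_itv (x + 1 / 2); rewrite intrD => /andP[h1 h2].
by rewrite ler_norml; apply/andP; split; lra.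
Qed.

(** Small divisors of the exponential sums: [cis2pi x] depends on [x] modulo
    [1] only, and the nearest integer reduces to [`|x| <= 1 / 2]. *)
Lemma cabs_1B_cis2pi_dist x (r : R) :
  (forall n : int, r <= `|x - n%:~R|) -> 2 * r <= cabs (1 - cis2pi x).
Proof.
move=> xr; have [n xn] := near_int x.
by rewrite -(cis2piB_int x n) (le_trans _ (cabs_1B_cis2pi_ge xn))// ler_pM2l.
Qed.

Lemma cabsB_cis2pi_le x y : cabs (cis2pi x - cis2pi y) <= 2 * pi * `|x - y|.
Proof.
have -> : cis2pi x - cis2pi y = cis2pi x * (1 - cis2pi (y - x)).
  by rewrite mulrBr mulr1 -cis2piD subrKC.
rewrite cabsM cabs_cis2pi mul1r cabs_1B_cis2pi.
rewrite -mulrA ler_pM2l//.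
apply: (@le_trans _ _ `|pi * (y - x)|); last first.
  by rewrite normrM (ger0_norm (pi_ge0 R)) distrC.
have : forall a : R, 0 <= a -> `|sin a| <= a.
  move=> a a0.
  have [c _] : exists2 c, c \in `[0, a]%R & sin a - sin 0 = cos c * (a - 0).
    have cs : {within `[0, a], continuous (@sin R)}.
    by apply: continuous_subspaceT; exact: continuous_sin.
  by apply: (MVT_segment _ (fun x _ => is_derive_sin x) cs); lra.
  rewrite sin0 !subr0 => ->; rewrite normrM (ger0_norm a0).
  by rewrite -[leRHS]mul1r ler_wpM2r// cos_max.
move: (pi * _) => a H; case: (ger0P a) => a0; first exact: H.
by rewrite -normrN -sinN H // oppr_ge0 ltW.
Qed.

End ComplexModulus.

(** * The real-valued norm *)

Section RealNorm.
Context {R : realType} {B : normedModType R[i]}.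
Implicit Types (u v : B).

Lemma normr_rnorm v : `|v| = (rnorm v)%:C.
Proof. by rewrite /rnorm RRe_real ?normr_real. Qed.

Lemma rnorm_ge0 v : 0 <= rnorm v.
Proof. by rewrite -lecR -normr_rnorm normr_ge0. Qed.

Lemma rnormN v : rnorm (- v) = rnorm v.
Proof. by rewrite /rnorm normrN. Qed.

Lemma rnormC u v : rnorm (u - v) = rnorm (v - u).
Proof. by rewrite -rnormN opprB. Qed.

Lemma rnormZ (c : R[i]) v : rnorm (c *: v) = cabs c * rnorm v.
Proof. by apply: complexI; rewrite rmorphM/= -normr_rnorm -normC_cabs normrZ -normr_rnorm. Qed.

Lemma ler_rnormD u v : rnorm (u + v) <= rnorm u + rnorm v.
Proof. by rewrite -lecR rmorphD/= -!normr_rnorm ler_normD. Qed.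

Lemma ler_rnorm_sum (I : Type) (r : seq I) (P : pred I) (F : I -> B) :
  rnorm (\sum_(i <- r | P i) F i) <= \sum_(i <- r | P i) rnorm (F i).
Proof.
rewrite -lecR -normr_rnorm (le_trans (ler_norm_sum _ _ _))//.
by rewrite rmorph_sum/= ler_sum// => i _; rewrite normr_rnorm.
Qed.

Lemma ler_rnormB u v : `|rnorm u - rnorm v| <= rnorm (u - v).
Proof.
have h1 := ler_rnormD (u - v) v; rewrite subrK in h1.
have h2 := ler_rnormD (v - u) u; rewrite subrK rnormC in h2.
by rewrite ler_norml; apply/andP; split; lra.
Qed.

Lemma rnorm_eq0 v : rnorm v = 0 -> v = 0.
Proof. by move=> v0; apply/normr0_eq0; rewrite normr_rnorm v0. Qed.

Lemma cvg_rnormP {I : Type} (F : set_system I) {FF : Filter F} (s : I -> B) l :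
  s @ F --> l <->
  forall e : R, 0 < e -> \forall x \near F, rnorm (l - s x) <= e.
Proof.
split=> [/cvgrPdist_le h e e0|h].
  have := h e%:C; rewrite ltcR => /(_ e0).
  by apply: filterS => x; rewrite normr_rnorm lecR.
apply/cvgrPdist_le => -[e ie]; rewrite ltcE /= => /andP[/eqP -> e0].
by have := h e e0; apply: filterS => x; rewrite normr_rnorm lecR.
Qed.

Lemma cvg_rnorm {I : Type} (F : set_system I) {FF : Filter F} (s : I -> B) l :
  s @ F --> l -> rnorm (s x) @[x --> F] --> rnorm l.
Proof.
move=> /cvg_rnormP h; apply/cvgrPdist_le => e /h.
by apply: filterS => x; apply: le_trans; exact: ler_rnormB.
Qed.

End RealNorm.

Lemma cauchy_rnorm_cvg {R : realType} {B : completeNormedModType R[i]}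
    (s : nat -> B) :
  (forall e : R, 0 < e -> exists N, forall n p, (N <= n)%N -> (N <= p)%N ->
     rnorm (s n - s p) <= e) ->
  exists l : B, s @ \oo --> l.
Proof.
move=> h; suff /cvg_ex[l] : cvg (s @ \oo) by exists l.
apply/cauchy_cvgP/cauchyP => -[e ie]; rewrite ltcE /= => /andP[/eqP -> e0].
have [|N hN] := h (e / 2); first by rewrite divr_gt0.
exists (s N); exists N => // n Nn /=.
rewrite -ball_normE /= normr_rnorm ltcR (le_lt_trans (hN _ _ _ _))//.
by rewrite ltr_pdivrMr// ltr_pMr// ltrDl.
Qed.

(** * Extension of the weight by zero *)

Section ZeroExtension.
Context {R : realType}.

Lemma cvg_quotient_is_derive (f : R -> R) (x l : R) :
  (forall e : R, 0 < e -> exists2 del : R, 0 < del & forall y, y != x ->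
     `|y - x| < del -> `|l - (f y - f x) / (y - x)| <= e) ->
  is_derive x 1 f l.
Proof.
move=> h.
have H : h^-1 *: ((f \o shift x) (h *: (1 : R)) - f x) @[h --> (0 : R)^'] --> l.
  apply/cvgrPdist_le => e /h[del del0 hd].
  have := @dnbhs0_lt R R _ del0; apply: filterS2 (nbhs_dnbhs_neq 0) => k kn0 kd.
  have := hd (k + x); rewrite addrK; rewrite -subr_eq0 addrK => /(_ kn0 kd).
  by rewrite /= scaler1 [_ *: _]mulrC.
by apply: DeriveDef; [apply/cvg_ex; exists l | exact/cvg_lim].
Qed.

Definition zero_ext (f : R -> R) (x : R) : R := if x \in `[0, 1] then f x else 0.

Lemma is_derive_withinP (f : R -> R) (x l : R) :
  is_derive_within `[0, 1] f x l ->
  forall e : R, 0 < e -> exists2 del : R, 0 < del & forall y, y != x ->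
     y \in `[0, 1] -> `|y - x| < del -> `|l - (f y - f x) / (y - x)| <= e.
Proof.
move=> /cvgrPdist_le h e /h; rewrite /within /= => -[del /= del0 hd].
exists del => // y yx yI yd; apply: hd => //=.
by rewrite distrC.
Qed.

(** Vanishing of [f] and [g] at the end points makes the two one-sided
    derivatives there agree. *)
Lemma zero_ext_is_derive (f g : R -> R) :
  (forall x, x \in `[0, 1] -> is_derive_within `[0, 1] f x (g x)) ->
  f 0 = 0 -> f 1 = 0 -> g 0 = 0 -> g 1 = 0 ->
  forall x : R, is_derive x 1 (zero_ext f) (zero_ext g x).
Proof.
move=> fg f0 f1 g0 g1 x; apply: cvg_quotient_is_derive => e e0.
rewrite /zero_ext; case: ifPn => xI; last first.
  exists (Num.max (0 - x) (x - 1)).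
    move: xI; rewrite in_itv/= negb_and -!ltNge lt_max => /orP[] ?.
    - by apply/orP; left; lra.
    - by apply/orP; right; lra.
  move=> y yx; case: ifPn; last by rewrite subrr mul0r subrr normr0 ltW.
  rewrite in_itv/= => /andP[y0 y1].
  move: xI; rewrite in_itv/= negb_and -!ltNge ltr_norml lt_max => xI /andP[h1 h2].
  exfalso; have hx : x < 0 \/ 1 < x by apply/orP.
  have h2' : y - x < 0 - x \/ y - x < x - 1 by apply/orP.
  case: (ltP (0 - x) (x - 1)) h1 h2 => ? h1 h2; lra.
have [del del0 hd] := is_derive_withinP (fg _ xI) e0.
have [x01|x01] : (x \in `]0, 1[) \/ (x = 0 \/ x = 1).
- move: xI; rewrite !in_itv/= => /andP[x0 x1].
  have [->|xn0] := eqVneq x 0; first by right; left.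
  have [->|xn1] := eqVneq x 1; first by right; right.
  by left; rewrite !lt_neqAle x0 x1 xn1 eq_sym xn0.
- exists (Num.min del (Num.min x (1 - x))).
    move: x01; rewrite in_itv/= => /andP[x0 x1].
    by rewrite !lt_min del0 x0 subr_gt0.
  move=> y yx; rewrite !lt_min => /andP[yd /andP[yl yr]].
  have yI : y \in `[0, 1].
    by move: yl yr; rewrite !ltr_norml in_itv/= => /andP[? ?] /andP[? ?]; lra.
  by rewrite yI; exact: hd.
exists del => // y yx yd; case: ifPn => yI; first exact: hd.
have [-> ->] : f x = 0 /\ g x = 0 by case: x01 => ->.
by rewrite subrr mul0r subrr normr0 ltW.
Qed.

(** A function with one-sided derivatives is continuous on the compact interval. *)
Lemma is_derive_within_bounded (f g : R -> R) :
  (forall x, x \in `[0, 1] -> is_derive_within `[0, 1] f x (g x)) ->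
  exists2 C : R, 0 <= C & forall x, `|zero_ext f x| <= C.
Proof.
move=> fg.
have cf : {within `[0, 1], continuous f}.
  apply/subspace_continuousP => x xI; apply/cvgrPdist_le => e e0.
  have [|del del0 hd] := is_derive_withinP (fg x xI) (e := 1); first exact: ltr01.
  have g1 : 0 < `|g x| + 1 by rewrite ltr_wpDl.
  exists (Num.min del (e / (`|g x| + 1))) => /=; first by rewrite lt_min del0 divr_gt0.
  move=> y; rewrite /= distrC lt_min => /andP[yd ye] yI.
  have [->|yx] := eqVneq y x; first by rewrite subrr normr0 ltW.
  have := hd _ yx yI yd.
  have y0 : 0 < `|y - x| by rewrite normr_gt0 subr_eq0.
  move=> h; have : `|(f y - f x) / (y - x)| <= `|g x| + 1.
    rewrite -(subKr (g x) (_ / _)) (le_trans (ler_normB _ _))//.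
    by rewrite lerD2l.
  rewrite normrM normfV ler_pdivrMr// distrC => /le_trans; apply.
  by rewrite -ler_pdivlMl// ltW// mulrC.
have cn : {within `[0, 1], continuous (fun x => `|f x|)}.
  by move=> x; apply: continuous_comp; [exact: cf|exact: norm_continuous].
have [c _ hc] := EVT_max ler01 cn.
exists `|f c| => // x; rewrite /zero_ext; case: ifPn => xI; first exact: hc.
by rewrite normr0.
Qed.

End ZeroExtension.

(** * Exponential sums weighted by w *)

Section FiniteDifferences.
Context {R : realType}.

(** Backward rather than forward differences, so that a function vanishing on the
    negative numbers keeps doing so. *)
Definition backward_diff (h : R) (F : R -> R) (x : R) : R := F x - F (x - h).

(** One backward difference costs, by the mean value theorem, a factor [h] and
    one derivative. *)
Lemma iter_backward_diff_le (m : nat) (F : nat -> R -> R) (C h : R) :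
  (forall j, (j < m)%N -> forall x : R, is_derive x 1 (F j) (F j.+1 x)) ->
  (forall x, `|F m x| <= C) -> 0 <= h ->
  forall x, `|iter m (backward_diff h) (F 0%N) x| <= C * h ^+ m.
Proof.
elim: m F C => [|m IH] F C dF FC h0 x; first by rewrite mulr1 FC.
rewrite iterSr exprS mulrA.
apply: (IH (fun j => backward_diff h (F j)) (C * h)) => // [j jm y|y].
  have d1 := dF j (leqW jm) y.
  have d2 := dF j (leqW jm) (y - h).
  have d3 : is_derive y 1 (F j \o (fun z => z - h)) (F j.+1 (y - h)).
    have d4 : is_derive y 1 (fun z : R => z - h) 1.
      by rewrite -[X in is_derive _ _ _ X](subr0 1); apply: is_deriveB.
    have := @is_derive1_comp R (F j) (fun z => z - h) y _ _ d2 d4.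
    by rewrite ?mul1r ?mulr1 ?scale1r ?scaler1.
  exact: is_deriveB.
rewrite /backward_diff.
have cF : {within `[y - h, y], continuous (F m)}.
  apply: continuous_subspaceT => z.
  by apply: differentiable_continuous; apply/derivable1_diffP; apply: ex_derive; exact: dF.
have yh : y - h <= y by lra.
have [c _ ->] := MVT_segment yh (fun z _ => dF m (ltnSn m) z) cF.
by rewrite subKr normrM (ger0_norm h0) ler_wpM2r.
Qed.

End FiniteDifferences.

Section WeightSums.
Context {R : realType} (m : nat) (w : R -> R).
Hypothesis hw : weighting_function m w.

Lemma weight_zero_ext : exists F : nat -> R -> R,
  [/\ F 0%N = zero_ext w,
      forall j, (j < m)%N -> forall x : R, is_derive x 1 (F j) (F j.+1 x),
      forall j, exists2 C : R, 0 <= C & forall x, `|F j x| <= C & F 0%N 1 = 0].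
Proof.
have [[dw [<- dd d0]] _ _] := hw.
exists (fun j => zero_ext (dw j)); split => //.
- move=> j jm; have [? ?] := d0 _ (ltnW jm); have [? ?] := d0 _ jm.
  by apply: zero_ext_is_derive => // x; exact: dd.
- by move=> j; apply: is_derive_within_bounded => x; exact: dd.
- by rewrite /zero_ext; case: ifPn => // _; have [_ ->] := d0 0%N (leq0n _).
Qed.

Lemma weight_ge0 x : x \in `[0, 1] -> 0 <= w x.
Proof.
have [[dw [dw0 _ d0]] w0 _] := hw; have [h0 h1] := d0 0%N (leq0n _).
rewrite dw0 in h0 h1.
rewrite in_itv/= => /andP[x0 x1].
have [->|xn0] := eqVneq x 0; first by rewrite h0.
have [->|xn1] := eqVneq x 1; first by rewrite h1.
by apply/ltW/w0; rewrite in_itv/= !lt_neqAle x0 x1 xn1 eq_sym xn0.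
Qed.

Lemma weight_lipschitz : (0 < m)%N -> exists2 C : R, 0 <= C &
  forall x y, x \in `[0, 1] -> y \in `[0, 1] -> `|w x - w y| <= C * `|x - y|.
Proof.
move=> m0; have [F [F0 dF bF _]] := weight_zero_ext.
have [C C0 FC] := bF 1%N; exists C => // x y xI yI.
wlog xy : x y xI yI / y <= x.
  by move=> H; case: (leP y x) => [/H|/ltW /H]; [exact|rewrite distrC (distrC x); exact].
have cF : {within `[y, x], continuous (F 0%N)}.
  apply: continuous_subspaceT => z.
  by apply: differentiable_continuous; apply/derivable1_diffP; apply: ex_derive; exact: dF.
have [c _] := MVT_segment xy (fun z _ => dF 0%N m0 z) cF.
rewrite F0 /zero_ext xI yI => ->.
by rewrite normrM ler_wpM2r.
Qed.

Lemma weight_bounded : exists2 C : R, 0 <= C & forall x, x \in `[0, 1] -> `|w x| <= C.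
Proof.
have [F [F0 _ bF _]] := weight_zero_ext; have [C C0 FC] := bF 0%N.
by exists C => // x xI; have := FC x; rewrite F0 /zero_ext xI.
Qed.

Definition weight_sum (N : nat) (a : R) : R[i] :=
  \sum_(0 <= n < N) (w (n%:R / N%:R))%:C * cis2pi (n%:R * a).

(** The exponential sum is a polynomial in [cis2pi a], and multiplication by
    [1 - 'X] is summation by parts. *)
Definition weight_poly (N : nat) : {poly R[i]} :=
  \poly_(n < N) (w (n%:R / N%:R))%:C.

Lemma weight_sumE N a : weight_sum N a = (weight_poly N).[cis2pi a].
Proof.
rewrite horner_poly /weight_sum big_mkord; apply: eq_bigr => n _.
by rewrite cis2pi_nat.
Qed.

Lemma ratio_in01 (n N : nat) : (n <= N)%N -> (n%:R / N%:R : R) \in `[0, 1].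
Proof.
move=> nN; rewrite in_itv/= divr_ge0//=.
case: N nN => [|N] nN; first by rewrite invr0 mulr0 ler01.
by rewrite ler_pdivrMr// mul1r ler_nat.
Qed.

(** Multiplication by [1 - 'X] subtracts from each coefficient its predecessor.
    The coefficient of index [0] has none: its difference involves the value at
    [- N%:R^-1], which is [0]; the second conjunct keeps track of this. *)
Lemma weight_poly_diff (F : R -> R) (N : nat) :
  (0 < N)%N -> F = zero_ext w -> F 1 = 0 -> forall j n,
  ((1 - 'X) ^+ j * weight_poly N)`_n =
    (iter j (backward_diff N%:R^-1) F (n%:R / N%:R))%:C /\
  (forall x, x < 0 -> iter j (backward_diff N%:R^-1) F x = 0).
Proof.
move=> N0 FE F1.
have Npos : 0 < N%:R :> R by rewrite ltr0n.
elim => [|j IH] n.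
  split; last by move=> x x0; rewrite /= FE /zero_ext in_itv/= leNgt x0.
  rewrite expr0 mul1r coef_poly /=; case: ltnP => nN.
    by rewrite FE /zero_ext ratio_in01// ltnW.
  have [->|nN'] := eqVneq n N; first by rewrite divff ?F1// gt_eqF.
  rewrite FE /zero_ext in_itv/= ler_pdivrMr// mul1r ler_nat leqNgt.
  by rewrite ltn_neqAle eq_sym nN' nN andbF.
split; last first.
  move=> x x0; rewrite iterS /backward_diff.
  rewrite (IH 0%N).2// (IH 0%N).2 ?subrr//.
  by rewrite (le_lt_trans _ x0)// gerBl invr_ge0 ler0n.
rewrite exprS -mulrA mulrBl mul1r coefB coefXM iterS /backward_diff.
rewrite rmorphB/= (IH n).1; congr (_ - _).
case: n => [|n] /=.
  by rewrite mul0r sub0r (IH 0%N).2// oppr_lt0 invr_gt0.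
by rewrite (IH n).1 -[X in _ - X]mul1r -mulrBl -[n.+1%:R]natr1 addrK.
Qed.

(** The polynomial [(1 - 'X) ^+ m * P] has at most [N + m <= N * (1 + m)]
    coefficients, each of them an [m]-th difference of step [1 / N]. *)
Lemma weight_sum_bound : exists2 C : R, 0 <= C & forall (N : nat) (a : R),
  (0 < N)%N -> cabs (weight_sum N a) * cabs (1 - cis2pi a) ^+ m
    <= N%:R * ((1 + m%:R) * C) / N%:R ^+ m.
Proof.
have [F [F0 dF bF F1]] := weight_zero_ext.
have [C C0 FC] := bF m; exists C => // N a N0.
have Npos : 0 < N%:R :> R by rewrite ltr0n.
pose Q := (1 - 'X) ^+ m * weight_poly N.
have -> : cabs (weight_sum N a) * cabs (1 - cis2pi a) ^+ m = cabs (Q.[cis2pi a]).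
  rewrite weight_sumE -cabsX -cabsM /Q !hornerE.
  by rewrite mulrC.
have sQ : (size Q <= N + m)%N.
  have h1 : (size ((1 - 'X : {poly R[i]})%R ^+ m)%R <= m.+1)%N.
    have s2 : (size (1 - 'X : {poly R[i]})%R <= 2)%N.
      by rewrite -opprB size_polyN -[1%R]/(1%:P) size_XsubC.
    rewrite (leq_trans (size_poly_exp_leq _ _))// ltnS.
    by rewrite -[leqRHS]mul1n leq_mul2r; apply/orP; right; case: size s2 => [|[|[]]].
  have h2 : (size (weight_poly N) <= N)%N by exact: size_poly.
  apply: (leq_trans (size_polyMleq _ _)).
  by move: (leq_add h1 h2); rewrite addSn (addnC m); case: (_ + _)%N.
rewrite (horner_coef_wide _ sQ) (le_trans (le_cabs_sum _ _ _))//.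
have -> : N%:R * ((1 + m%:R) * C) / N%:R ^+ m =
    \sum_(i < N * m.+1) (C * N%:R^-1 ^+ m).
  rewrite sumr_const card_ord -[RHS]mulr_natl natrM -natr1 exprVn; ring.
apply: (@le_trans _ _ (\sum_(i < N + m) (C * N%:R^-1 ^+ m))); last first.
  rewrite !sumr_const !card_ord ler_wpMn2l//; last by rewrite mulnS leq_add2l leq_pmull.
  by rewrite mulr_ge0// exprn_ge0// invr_ge0 ler0n.
apply: ler_sum => i _; rewrite cabsM cabsX cabs_cis2pi expr1n mulr1.
rewrite (weight_poly_diff N0 F0 F1 m i).1 cabs_real.
by apply: iter_backward_diff_le => //; rewrite invr_ge0 ler0n.
Qed.

End WeightSums.

(** * Functions factoring through finitely many fibers *)

Section FiniteFactorization.
Context {R : realType} {dT : measure_display} {T : measurableType dT}.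
Variables (mu : {measure set T -> \bar R}) (D : set T).
Hypotheses (mD : measurable D) (muD : (mu D < +oo)%E).
Context {X : choiceType}.
Variables (p : T -> X) (A : seq X).
Hypotheses (uA : uniq A) (pA : forall t, D t -> p t \in A).
Hypothesis mp : forall x, measurable (D `&` p @^-1` [set x]).

Let fiber (x : X) : set T := D `&` p @^-1` [set x].

Lemma indic_fibers (G : X -> R) t : D t ->
  G (p t) = \sum_(x <- A) G x * \1_(fiber x) t.
Proof.
move=> Dt; rewrite (bigD1_seq (p t)) ?pA//= indicE mem_set ?mulr1; last by split.
rewrite big1 ?addr0// => x xp; rewrite indicE memNset ?mulr0// => -[_ /= ptx].
by rewrite ptx eqxx in xp.
Qed.

Lemma measurable_factor (G : X -> R) : measurable_fun D (G \o p).
Proof.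
apply: (@eq_measurable_fun _ _ _ _ D (fun t => \sum_(x <- A) G x * \1_(fiber x) t)).
  by move=> t /set_mem Dt; rewrite /= -indic_fibers.
apply: measurable_sum => x; apply: measurable_funM; first exact: measurable_cst.
exact/measurable_indic/mp.
Qed.

Lemma ge0_integral_factor (G : X -> R) : (forall x, 0 <= G x) ->
  (\int[mu]_(t in D) (G (p t))%:E = \sum_(x <- A) (G x)%:E * mu (fiber x))%E.
Proof.
move=> G0.
rewrite (eq_integral (fun t => (\sum_(x <- A) (G x)%:E * (\1_(fiber x) t)%:E)%E)); last first.
  move=> t /set_mem Dt; rewrite (indic_fibers _ Dt) -sumEFin.
  by apply: eq_bigr => x _; rewrite EFinM.
rewrite ge0_integral_sum//.
- apply: eq_bigr => x _; rewrite ge0_integralZl_EFin//.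
  + rewrite integral_indic//; last exact: mp.
    by rewrite (_ : fiber x `&` D = fiber x)// setIAC setIid.
  + by apply/measurable_EFinP; exact/measurable_indic/mp.
- move=> x; apply: measurable_funeM.
  by apply/measurable_EFinP; exact/measurable_indic/mp.
- by move=> x t _; rewrite mule_ge0// lee_fin.
Qed.

Lemma fiber_fin_num x : mu (fiber x) \is a fin_num.
Proof.
rewrite ge0_fin_numE// (le_lt_trans _ muD)//.
by apply: le_measure; rewrite ?inE//; [exact: mp|move=> t []].
Qed.

Context {B : normedModType R[i]}.

(** The measure of a fiber is the integral of its indicator, which is a function
    of [p]. *)
Lemma factor_fiber_measure (F : X -> B) (v : B) :
  measurable (D `&` (F \o p) @^-1` [set v]) /\
  mu (D `&` (F \o p) @^-1` [set v]) = (\sum_(x <- A | F x == v) mu (fiber x))%E.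
Proof.
pose G x : R := (F x == v)%:R.
have E : D `&` (F \o p) @^-1` [set v] = D `&` (G \o p) @^-1` [set 1].
  apply/seteqP; split => t [Dt] /=; rewrite /G.
    by move=> ->; rewrite eqxx.
  by case: eqP => // _ /esym/eqP; rewrite oner_eq0.
have mE : measurable (D `&` (F \o p) @^-1` [set v]).
  by rewrite E; apply: measurable_factor.
split=> //.
transitivity (\int[mu]_(t in D) (G (p t))%:E)%E.
  rewrite -[LHS](_ : mu ((D `&` (F \o p) @^-1` [set v]) `&` D) = _); last first.
    by rewrite setIAC setIid.
  rewrite -integral_indic//; apply: eq_integral => t /set_mem Dt.
  rewrite indicE /G; congr (_%:R)%:E; congr (nat_of_bool _).
  apply/idP/idP => [/set_mem[_ /= ->]|/eqP Fv]; first by rewrite eqxx.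
  by apply/mem_set; split.
rewrite ge0_integral_factor// [RHS]big_mkcond; apply: eq_bigr => x _.
by rewrite /G; case: eqP => _; rewrite ?mul1e ?mul0e.
Qed.

Lemma factor_simple_fun (F : X -> B) : simple_fun mu D (F \o p).
Proof.
split.
- apply: (@sub_finite_set _ _ [set` map F A]); last exact: finite_seq.
  by move=> _ [t Dt <-] /=; apply/map_f/pA.
- by move=> v; exact: (factor_fiber_measure F v).1.
- move=> v _; rewrite (le_lt_trans _ muD)//.
  have [mFv _] := factor_fiber_measure F v.
  by apply: le_measure; [exact/mem_set|exact/mem_set|move=> t []].
Qed.

(** The defining sum runs over the values of [F \o p]; grouping the indices [x]
    by the value [F x] removes the dependence on coincidences among these values.
    Taking for [p] a pair of simple functions yields common refinements, and
    taking the index of a subinterval yields step functions. *)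
Lemma factor_simple_integral (F : X -> B) :
  simple_integral mu D (F \o p) = \sum_(x <- A) (fine (mu (fiber x)))%:C *: F x.
Proof.
rewrite /simple_integral (@fsbig_fwiden _ _ _ _ (undup (map F A))); first last.
- move=> v [_ /= vN]; rewrite (_ : _ `&` _ = set0) ?measure0 ?scale0r//.
  by apply/seteqP; split => // t [Dt /= Fv]; apply: vN; exists t.
- exact: undup_uniq.
- by move=> _ [t Dt <-] /=; rewrite mem_undup; apply/map_f/pA.
transitivity (\sum_(v <- undup (map F A)) \sum_(x <- A | F x == v)
    (fine (mu (fiber x)))%:C *: F x).
  apply: eq_bigr => v _; rewrite (factor_fiber_measure F v).2.
  rewrite -sum_fine; last by move=> x _; exact: fiber_fin_num.
  rewrite rmorph_sum/= scaler_suml; apply: eq_bigr => x /eqP <- //.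
rewrite (exchange_big_dep xpredT)//= [LHS]big_seq [RHS]big_seq.
apply: eq_bigr => x xA; rewrite -big_filter.
rewrite (_ : [seq _ <- _ | _] = [:: F x]) ?big_seq1//.
have := filter_pred1_uniq (undup_uniq (map F A)).
move=> /(_ (F x)) <-; last by rewrite mem_undup map_f.
by apply: eq_filter => v; rewrite /= eq_sym.
Qed.

End FiniteFactorization.

(** * Bochner integrals of uniform limits *)

Section BochnerTheory.
Context {R : realType} {B : completeNormedModType R[i]}.
Context {dT : measure_display} {T : measurableType dT}.
Variables (mu : {measure set T -> \bar R}) (D : set T).
Hypotheses (mD : measurable D) (muD : (mu D < +oo)%E).

Section Pair.
Variables s1 s2 : T -> B.
Hypotheses (hs1 : simple_fun mu D s1) (hs2 : simple_fun mu D s2).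

Let p t := (s1 t, s2 t).

Let A : {fset B * B} := fset_set (p @` D).

Let finA : finite_set (p @` D).
Proof.
have [f1 _ _] := hs1; have [f2 _ _] := hs2.
apply: (sub_finite_set _ (finite_setX f1 f2)).
by move=> _ [t Dt <-]; split; exists t.
Qed.

Let pA t : D t -> p t \in enum_fset A.
Proof. by move=> Dt; rewrite (in_fset_set finA) inE; exists t. Qed.

Let mp x : measurable (D `&` p @^-1` [set x]).
Proof.
have [_ m1 _] := hs1; have [_ m2 _] := hs2.
rewrite (_ : _ `&` _ = (D `&` s1 @^-1` [set x.1]) `&` (D `&` s2 @^-1` [set x.2])).
  exact: measurableI.
apply/seteqP; split=> t /=; first by move=> [Dt <-].
by case: x => x1 x2 /= [[Dt <-] [_ <-]].
Qed.

Lemma simple_dist_measurable : measurable_fun D (fun t => rnorm (s1 t - s2 t)).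
Proof.
exact: (measurable_factor (fset_uniq A) pA mp (fun x => rnorm (x.1 - x.2))).
Qed.

(** Both integrals are sums over the common refinement by the pair [p]. *)
Lemma simple_integral_dist :
  ((rnorm (simple_integral mu D s1 - simple_integral mu D s2))%:E
   <= \int[mu]_(t in D) (rnorm (s1 t - s2 t))%:E)%E.
Proof.
have uA := fset_uniq A.
have H (i : B * B -> B) := factor_simple_integral mD muD uA pA mp i.
rewrite (H fst) (H snd) -sumrB.
rewrite (ge0_integral_factor mu mD uA pA mp (fun x => rnorm_ge0 (x.1 - x.2))).
rewrite (eq_bigr (fun x => (rnorm (x.1 - x.2) *
    fine (mu (D `&` p @^-1` [set x])))%:E)); last first.
  move=> x _.
  by rewrite EFinM fineK// (fiber_fin_num mD muD mp).
rewrite sumEFin lee_fin (le_trans (ler_rnorm_sum _ _ _))// ler_sum// => x _.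
by rewrite -scalerBr rnormZ cabs_real ger0_norm ?fine_ge0// mulrC.
Qed.

End Pair.

(** The point is uniqueness. For every simple [s] the function [rnorm (f - s)] is
    a pointwise limit of the simple [rnorm (s_ n - s)], hence measurable, so the
    integral of a sum of two such functions splits and the triangle inequality
    compares [s_] with any other approximating sequence. *)
Lemma bochner_integral_uniform (f : T -> B) (s_ : nat -> T -> B) (J : B) :
  (forall n, simple_fun mu D (s_ n)) ->
  (forall e : R, 0 < e -> \forall n \near \oo, forall t, D t ->
     rnorm (f t - s_ n t) <= e) ->
  simple_integral mu D (s_ n) @[n --> \oo] --> J ->
  bochner_integral mu D f = J.
Proof.
move=> hs he hJ.
have fs t : D t -> s_ n t @[n --> \oo] --> f t.
  move=> Dt; apply/cvg_rnormP => r r0.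
  by have := he r r0; apply: filterS => n; apply.
have mfs s : simple_fun mu D s -> measurable_fun D (fun t => rnorm (f t - s t)).
  move=> hs'; apply: (@measurable_fun_cvg _ _ _ _ (fun n t => rnorm (s_ n t - s t))).
    by move=> n; exact: simple_dist_measurable.
  by move=> t Dt; apply: cvg_rnorm; apply: cvgB; [exact: fs|exact: cvg_cst].
have muDfin : mu D \is a fin_num by rewrite ge0_fin_numE.
have int_ge0 s : (0 <= \int[mu]_(t in D) (rnorm (f t - s t))%:E)%E.
  by apply: integral_ge0 => t _; rewrite lee_fin rnorm_ge0.
have ee (e : R) : 0 < e -> \forall n \near \oo,
    (\int[mu]_(t in D) (rnorm (f t - s_ n t))%:E <= (e * fine (mu D))%:E)%E.
  move=> e0; have := he e e0; apply: filterS => n hn.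
  rewrite EFinM fineK// -integral_cst//; apply: ge0_le_integral => //.
  - by move=> t _; rewrite lee_fin rnorm_ge0.
  - by apply/measurable_EFinP; exact: mfs.
have int0 : (\int[mu]_(t in D) (rnorm (f t - s_ n t))%:E)%E @[n --> \oo] --> 0%E.
  apply/fine_cvgP; split.
    have := ee 1 ltr01; apply: filterS => n hn.
    by rewrite ge0_fin_numE// (le_lt_trans hn)// ltry.
  apply/cvgrPdist_le => e e0.
  have d0 : 0 < fine (mu D) + 1 by rewrite ltr_wpDl// fine_ge0.
  have := ee (e / (fine (mu D) + 1)) (divr_gt0 e0 d0); apply: filterS => n hn.
  rewrite sub0r normrN ger0_norm ?fine_ge0//.
  rewrite -lee_fin fineK; last by rewrite ge0_fin_numE// (le_lt_trans hn)// ltry.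
  apply: (le_trans hn); rewrite lee_fin -mulrA ler_piMr ?(ltW e0)//.
  by rewrite mulrC ler_pdivrMr// mul1r lerDl.
have isJ : is_bochner_integral mu D f J.
  by exists s_; split => //; apply: aeW => t Dt; exact: fs.
have uniqJ I : is_bochner_integral mu D f I -> I = J.
  move=> [s' [hs' _ /fine_cvgP[fin' int'] hI]].
  move/fine_cvgP : int0 => [fin0 int0].
  apply/eqP; rewrite -subr_eq0; apply/eqP/rnorm_eq0/eqP; rewrite eq_le rnorm_ge0 andbT.
  have c1 : rnorm (simple_integral mu D (s' n) - simple_integral mu D (s_ n))
      @[n --> \oo] --> rnorm (I - J) by apply: cvg_rnorm; exact: cvgB.
  have c2 : (fine (\int[mu]_(t in D) (rnorm (f t - s' n t))%:E)
      + fine (\int[mu]_(t in D) (rnorm (f t - s_ n t))%:E)) @[n --> \oo] --> (0 : R).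
    by rewrite -[X in _ --> X](addr0 (0 : R)); exact: cvgD.
  apply: (ler_cvg_to c1 c2); apply: filterS2 fin' fin0 => n fin'n fin0n.
  rewrite -lee_fin (le_trans (simple_integral_dist (hs' n) (hs n)))//.
  rewrite EFinD !fineK//.
  rewrite -ge0_integralD//; first last.
  - by apply/measurable_EFinP; exact: mfs.
  - by move=> t _; rewrite lee_fin rnorm_ge0.
  - by apply/measurable_EFinP; exact: mfs.
  - by move=> t _; rewrite lee_fin rnorm_ge0.
  apply: ge0_le_integral => //.
  - by move=> t _; rewrite lee_fin rnorm_ge0.
  - by apply/measurable_EFinP; exact: simple_dist_measurable.
  - by apply: emeasurable_funD; apply/measurable_EFinP; exact: mfs.
  - move=> t _; rewrite -EFinD lee_fin (rnormC (f t) (s' n t)).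
    have := ler_rnormD (s' n t - f t) (f t - s_ n t).
    by rewrite addrA subrK.
apply: uniqJ.
exact: (@xgetPex _ 0 [set I | is_bochner_integral mu D f I] (ex_intro _ J isJ)).
Qed.

End BochnerTheory.

(** * Riemann sums *)

Section RiemannSteps.
Context {R : realType} (L : R) (n : nat).
Hypothesis L0 : 0 < L.
Local Notation D := (`[0, L]%classic : set R).
Let h : R := L / n.+1%:R.

Let h0 : 0 < h. Proof. by rewrite divr_gt0. Qed.

Definition step_index (t : R) : nat := Num.truncn (t / h).

Definition step_point (j : nat) : R := j%:R * h.

Let hL : n.+1%:R * h = L.
Proof. by rewrite /h mulrCA mulfV ?mulr1// pnatr_eq0. Qed.

Lemma step_indexP (t : R) : D t ->
  step_point (step_index t) <= t < step_point (step_index t) + h.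
Proof.
rewrite /= in_itv/= => /andP[t0 tL].
have /truncn_itv/andP[h1 h2] : 0 <= t / h by rewrite divr_ge0// ltW.
move: h1 h2; rewrite ler_pdivlMr// ltr_pdivrMr// => h1 h2.
by rewrite /step_point h1/=; move: h2; rewrite -natr1 mulrDl mul1r.
Qed.

Lemma step_index_le (t : R) : D t -> (step_index t <= n.+1)%N.
Proof.
move=> Dt; have /andP[h1 _] := step_indexP Dt.
move: Dt; rewrite /= in_itv/= => /andP[_ tL].
by have := le_trans h1 tL; rewrite /step_point -[X in _ <= X]hL ler_pM2r// ler_nat.
Qed.

Lemma step_pointP (t : R) : D t ->
  D (step_point (step_index t)) /\ `|t - step_point (step_index t)| <= h.
Proof.
move=> Dt; have /andP[h1 h2] := step_indexP Dt; split.
  rewrite /= in_itv/= (le_trans h1) ?andbT; last first.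
    by move: Dt; rewrite /= in_itv/= => /andP[].
  by rewrite mulr_ge0// ltW.
by rewrite ger0_norm ?subr_ge0// lerBlDl ltW.
Qed.

Lemma step_fiberE (j : nat) :
  D `&` step_index @^-1` [set j] = D `&` `[step_point j, step_point j + h[%classic.
Proof.
apply/seteqP; split => t [Dt] /=.
  by move=> <-; split => //; rewrite in_itv/=; exact: step_indexP.
rewrite in_itv/= => /andP[h1 h2]; split => //; apply: truncn_def.
by rewrite ler_pdivlMr// ltr_pdivrMr// h1/= -natr1 mulrDl mul1r.
Qed.

Lemma step_fiber_measurable (j : nat) :
  measurable (D `&` step_index @^-1` [set j]).
Proof. by rewrite step_fiberE; apply: measurableI; exact: measurable_itv. Qed.

(** The index [n.+1] occurs at the right end point [L] only. *)
Lemma step_fiber_measure (j : nat) : (j <= n.+1)%N ->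
  lebesgue_measure (D `&` step_index @^-1` [set j]) =
    (if (j <= n)%N then h else 0)%:E.
Proof.
move=> jn; rewrite step_fiberE; case: ifPn => [jn'|].
  have -> : D `&` `[step_point j, step_point j + h[%classic =
            `[step_point j, step_point j + h[%classic.
    apply/seteqP; split => t; first by move=> [].
    move=> tI; split => //; move: tI; rewrite /= !in_itv/= => /andP[h1 h2].
    rewrite (le_trans _ h1)/=; last by rewrite mulr_ge0// ltW.
    rewrite (le_trans (ltW h2))// -hL /step_point -[X in _ + X]mul1r -mulrDl natr1.
    by rewrite ler_pM2r// ler_nat.
  by rewrite lebesgue_measure_itv/= lte_fin ltrDl h0 -EFinB addrAC subrr add0r.
rewrite -ltnNge => nj; have -> : j = n.+1 by apply/eqP; rewrite eqn_leq jn.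
rewrite (_ : _ `&` _ = [set L]) ?lebesgue_measure_set1//.
rewrite /step_point hL; apply/seteqP; split => t /=.
  by rewrite !in_itv/= => -[/andP[_ h1] /andP[h2 _]]; apply/eqP; rewrite eq_le h1.
by move=> ->; rewrite !in_itv/= lexx (ltW L0) ltrDl h0.
Qed.

(** Generic in the scaling [c], to serve both real and vector-valued integrands. *)
Lemma big_steps {V : nmodType} (F : nat -> V) (c : R -> V -> V) :
  (forall v, c 0 v = 0) ->
  \sum_(j <- iota 0 n.+2)
      c (fine (lebesgue_measure (D `&` step_index @^-1` [set j]))) (F j) =
  \sum_(0 <= j < n.+1) c h (F j).
Proof.
move=> c0; rewrite -[n.+2]subn0 -/(index_iota 0 n.+2) big_nat_recr//=.
rewrite step_fiber_measure// ltnn c0 addr0.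
rewrite big_nat [RHS]big_nat; apply: eq_bigr => j /= jn.
have jn' : (j <= n)%N by [].
by rewrite step_fiber_measure ?(leqW jn')// jn'.
Qed.

End RiemannSteps.

Lemma near_step_lt {R : realType} (L del : R) : 0 < L -> 0 < del ->
  \forall n \near \oo, L / n.+1%:R < del.
Proof.
move=> L0 d0; have := near_infty_natSinv_lt (PosNum (divr_gt0 d0 L0)).
apply: filterS => n /=; rewrite ltr_pdivlMr// mulrC; apply.
Qed.

Lemma itv0L_measure_lty {R : realType} (L : R) : 0 < L ->
  (lebesgue_measure (`[0%R, L]%classic : set R) < +oo)%E.
Proof. by move=> L0; rewrite lebesgue_measure_itv/= lte_fin L0 -EFinB ltry. Qed.

(** The step functions of the left Riemann sums converge uniformly, and their
    integrals form a Cauchy sequence by [simple_integral_dist]. *)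
Lemma bochner_integral_riemann {R : realType} {B : completeNormedModType R[i]}
    (L : R) (g : R -> B) : 0 < L ->
  (forall e : R, 0 < e -> exists2 del : R, 0 < del & forall s t : R,
     s \in `[0, L] -> t \in `[0, L] -> `|s - t| <= del ->
     rnorm (g s - g t) <= e) ->
  (L / n.+1%:R)%:C *: (\sum_(0 <= j < n.+1) g (step_point L n j)) @[n --> \oo]
    --> bochner_integral lebesgue_measure `[0, L] g.
Proof.
move=> L0 ucg; set D : set R := `[0, L]%classic.
have mD : measurable D by exact: measurable_itv.
have muD : (lebesgue_measure D < +oo)%E by exact: itv0L_measure_lty.
pose s_ n : R -> B := (g \o step_point L n) \o step_index L n.
have u n : uniq (iota 0 n.+2) by exact: iota_uniq.
have pA n (t : R) : D t -> step_index L n t \in iota 0 n.+2.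
  by move=> Dt; rewrite mem_iota add0n ltnS; exact: step_index_le.
have mp n := step_fiber_measurable n L0.
have hs n : simple_fun lebesgue_measure D (s_ n).
  exact: (factor_simple_fun (mu := lebesgue_measure) mD muD (u n) (pA n) (mp n)).
have Is n : simple_integral lebesgue_measure D (s_ n) =
    (L / n.+1%:R)%:C *: (\sum_(0 <= j < n.+1) g (step_point L n j)).
  rewrite (factor_simple_integral (mu := lebesgue_measure) mD muD (u n) (pA n) (mp n)).
  rewrite (big_steps n L0 (g \o step_point L n) (c := fun r v => r%:C *: v)).
    by rewrite scaler_sumr.
  by move=> v; rewrite scale0r.
have he (e : R) : 0 < e -> \forall n \near \oo, forall t, D t -> rnorm (g t - s_ n t) <= e.
  move=> /ucg[del d0 hd]; have := near_step_lt L0 d0; apply: filterS => n hn t Dt.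
  have [Dp dp] := step_pointP n L0 Dt.
  by apply: hd => //; rewrite (le_trans dp)// ltW.
have [J hJ] : exists J : B, simple_integral lebesgue_measure D (s_ n) @[n --> \oo] --> J.
  apply: cauchy_rnorm_cvg => e e0.
  have muDfin : lebesgue_measure D \is a fin_num by rewrite ge0_fin_numE.
  have d0 : 0 < fine (lebesgue_measure D) + 1 by rewrite ltr_wpDl// fine_ge0.
  pose e' := e / 2 / (fine (lebesgue_measure D) + 1).
  have e'0 : 0 < e' by rewrite !divr_gt0.
  have [N _ hN] := he e' e'0; exists N => n p Nn Np.
  rewrite -lee_fin (le_trans (simple_integral_dist (mu := lebesgue_measure) mD muD (hs n) (hs p)))//.
  apply: (@le_trans _ _ (\int[lebesgue_measure]_(t in D) (cst (e' *+ 2)%:E t))%E).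
    apply: ge0_le_integral => //.
    - by move=> t _; rewrite lee_fin rnorm_ge0.
    - by apply/measurable_EFinP; exact: simple_dist_measurable.
    - move=> t Dt; rewrite lee_fin mulr2n.
      have := ler_rnormD (s_ n t - g t) (g t - s_ p t); rewrite addrA subrK => /le_trans; apply.
      by rewrite lerD ?(rnormC (s_ n t))//; apply: hN.
  rewrite integral_cst// -[X in (_ * X <= _)%E](fineK muDfin) -EFinM lee_fin /e'.
  rewrite -mulrnAl -mulr_natr divfK// mulrAC ler_pdivrMr// ler_pM2l//.
  by rewrite lerDl.
rewrite (bochner_integral_uniform (mu := lebesgue_measure) mD muD hs he hJ).
by move: hJ; under eq_fun do rewrite Is.
Qed.

(** The Lipschitz bound makes [w] uniformly close to its step functions, whose
    integrals are the Riemann sums. *)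
Lemma riemann_sum_cvg {R : realType} (w : R -> R) (C : R) : 0 <= C ->
  (forall x : R, x \in `[0, 1] -> 0 <= w x) ->
  (forall x y : R, x \in `[0, 1] -> y \in `[0, 1] -> `|w x - w y| <= C * `|x - y|) ->
  (n.+1%:R^-1 * \sum_(0 <= j < n.+1) w (j%:R / n.+1%:R)) @[n --> \oo] -->
    \int[lebesgue_measure]_(x in `[0, 1]) w x.
Proof.
move=> C0 w0 wC; set D : set R := `[0, 1]%classic.
have mD : measurable D by exact: measurable_itv.
have muD : lebesgue_measure D = 1%E.
  by rewrite lebesgue_measure_itv/= lte_fin ltr01 -EFinB subr0.
(* The absolute value makes G nonnegative at the step points beyond 1. *)
pose G n j := `|w (step_point 1 n j)|.
have pA n (t : R) : D t -> step_index 1 n t \in iota 0 n.+2.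
  by move=> Dt; rewrite mem_iota add0n ltnS; apply: step_index_le.
have mp n := step_fiber_measurable n (@ltr01 R).
have u n : uniq (iota 0 n.+2) by exact: iota_uniq.
have mG n : measurable_fun D (G n \o step_index 1 n).
  exact: (measurable_factor (u n) (pA n) (mp n)).
have dist n t : D t -> `|w t - G n (step_index 1 n t)| <= C / n.+1%:R.
  move=> Dt; have [Dp dp] := step_pointP n (@ltr01 R) Dt.
  rewrite /G (ger0_norm (w0 _ Dp)) (le_trans (wC _ _ Dt Dp))// ler_wpM2l//.
  by move: dp; rewrite mul1r.
pose S n : R := n.+1%:R^-1 * \sum_(0 <= j < n.+1) w (j%:R / n.+1%:R).
have intG n : (\int[lebesgue_measure]_(t in D) (G n (step_index 1 n t))%:E)%E = (S n)%:E.
  rewrite (ge0_integral_factor lebesgue_measure mD (u n) (pA n) (mp n)); last by move=> j; exact: normr_ge0.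
  have := big_steps n (@ltr01 R) (G n) (c := fun r v => r * v) (fun v => mul0r v).
  rewrite mul1r -mulr_sumr /S => E.
  rewrite (_ : \sum_(0 <= j < n.+1) w (j%:R / n.+1%:R) = \sum_(0 <= j < n.+1) G n j); last first.
    rewrite big_nat [RHS]big_nat; apply: eq_bigr => j /= jn.
    by rewrite /G /step_point mul1r ger0_norm// w0// ratio_in01// ltnW.
  rewrite -E -sumEFin; apply: eq_bigr => j _.
  rewrite EFinM fineK 1?muleC//.
  have [_ mDlt] : measurable D /\ (lebesgue_measure D < +oo)%E by rewrite muD ltry.
  exact: (fiber_fin_num (mu := lebesgue_measure) mD mDlt (mp n)).
have near0 (e : R) : 0 < e -> \forall n \near \oo, C / n.+1%:R <= e.
  move=> e0; have C1 : 0 < C + 1 by rewrite ltr_wpDl.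
  have := near_step_lt (@ltr01 R) (divr_gt0 e0 C1); apply: filterS => n.
  rewrite ltr_pdivlMr// => /ltW; apply: le_trans; rewrite mul1r mulrC.
  by rewrite ler_wpM2l// lerDl.
have mw : measurable_fun D w.
  apply: (@measurable_fun_cvg _ _ _ _ (fun n => G n \o step_index 1 n)) => // t Dt.
  apply/cvgrPdist_le => e /near0; apply: filterS => n.
  exact: le_trans (dist n t Dt).
have Ch n : 0 <= C / n.+1%:R by rewrite divr_ge0.
have intC n : (\int[lebesgue_measure]_(t in D) (C / n.+1%:R)%:E)%E = (C / n.+1%:R)%:E.
  by rewrite integral_cst// -[RHS]mule1; congr (_ * _)%E; exact: muD.
have G0 n t : (0 <= (G n (step_index 1 n t))%:E :> \bar R)%E by rewrite lee_fin normr_ge0.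
have ub n : (\int[lebesgue_measure]_(t in D) (w t)%:E <= (S n + C / n.+1%:R)%:E)%E.
  rewrite EFinD -intG -intC -ge0_integralD//; first last.
  - by move=> t _; rewrite lee_fin.
  - by apply/measurable_EFinP; exact: mG.
  apply: ge0_le_integral => //.
  - by apply/measurable_EFinP.
  - by apply: emeasurable_funD => //; apply/measurable_EFinP; exact: mG.
  - move=> t Dt; rewrite -EFinD lee_fin.
    by have := dist n t Dt; rewrite ler_norml => /andP[_]; rewrite lerBlDl.
have lb n : ((S n)%:E <= \int[lebesgue_measure]_(t in D) (w t)%:E + (C / n.+1%:R)%:E)%E.
  rewrite -intG -intC -ge0_integralD//; first last.
  - by move=> t _; rewrite lee_fin.
  - by apply/measurable_EFinP.
  apply: ge0_le_integral => //.
  - by apply/measurable_EFinP; exact: mG.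
  - by apply: emeasurable_funD => //; apply/measurable_EFinP.
  - move=> t Dt; rewrite -EFinD lee_fin.
    by have := dist n t Dt; rewrite ler_norml => /andP[+ _]; rewrite lerNl opprB lerBlDl.
have fin : (\int[lebesgue_measure]_(t in D) (w t)%:E)%E \is a fin_num.
  rewrite ge0_fin_numE; first by rewrite (le_lt_trans (ub 0%N))// ltry.
  by apply: integral_ge0 => t Dt; rewrite lee_fin w0.
apply/cvgrPdist_le => e /near0; apply: filterS => n; apply: le_trans.
have := ub n; have := lb n; rewrite -(fineK fin) -EFinD !lee_fin -/(S n).
rewrite -[X in `|X - _|]/(fine (\int[lebesgue_measure]_(t in D) (w t)%:E)%E).
set I := fine _; rewrite ler_norml => h1 h2.
by rewrite lerNl opprB !lerBlDl h1.
Qed.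

(** * Characters along an orbit *)

Section Frequencies.
Context {R : realType} (eta : nat).
Implicit Types (k : nat -> int) (x : nat -> R).

Let term k j : R := (maxn 1 j ^ eta * `|k j|%N)%:R.

Let term_ge1 k j : k j != 0 -> 1 <= term k j.
Proof.
move=> kj; rewrite /term ler1n muln_gt0 expn_gt0 leq_max /=.
by rewrite absz_gt0.
Qed.

(** A nonzero [k j] contributes at least [1] to the norm, whereas the tails of a
    convergent series tend to [0]. *)
Lemma Zstar_support k : Zstar R eta k ->
  exists n, forall j, (n <= j)%N -> k j = 0.
Proof.
move=> hk; have t0 j : (0 <= (term k j)%:E)%E by rewrite lee_fin.
have := nneseries_tail_cvg (P := xpredT) hk (fun j _ => t0 j).
move=> /fine_cvgP[fin /cvgrPdist_lt/(_ 1 ltr01) h].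
have [n _ hn] := filterI fin h.
exists n => j nj; apply/eqP/negPn/negP => /term_ge1 tj.
have [/= fj] := hn j nj; rewrite sub0r normrN ger0_norm; last first.
  by rewrite fine_ge0// nneseries_ge0.
apply/negP; rewrite -leNgt -lee_fin fineK//.
apply: le_trans (nneseries_lim_ge (P := xpredT) j.+1 (fun i _ _ => t0 i)).
by rewrite big_nat1 lee_fin.
Qed.

Lemma Zstar_0 : Zstar R eta (fun=> 0).
Proof.
rewrite /Zstar /= /eta_norme eseries0 ?ltry// => i _ _.
by rewrite absz0 muln0.
Qed.

Lemma eta_norm_ge1 k : Zstar_neq0 R eta k -> 1 <= eta_norm eta k :> R.
Proof.
move=> [hk /= k0]; have t0 j : (0 <= (term k j)%:E)%E by rewrite lee_fin.
have [j kj] : exists j, k j != 0.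
  apply: contrapT => /forallNP h; apply: k0; apply: funext => j.
  by apply/eqP/negPn/negP; exact: h.
rewrite -lee_fin fineK; last first.
  by rewrite ge0_fin_numE// nneseries_ge0.
apply: le_trans (nneseries_lim_ge (P := xpredT) j.+1 (fun i _ _ => t0 i)).
rewrite big_nat_recr//= (le_trans _ (leeDr _ _))//; last by rewrite sume_ge0.
by rewrite lee_fin; exact: term_ge1.
Qed.

Lemma pairing_finite k : Zstar R eta k ->
  exists n, forall x, pairing k x = \sum_(j < n) (k j)%:~R * x j.
Proof.
move=> /Zstar_support[n hn]; exists n => x.
rewrite (fsbig_ord _ _ (fun j => (k j)%:~R * x j)) /pairing.
apply/esym/fsbig_widen => // j [_ /= /negP].
by rewrite -leqNgt => /hn ->; rewrite mul0r.
Qed.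

Lemma pairing0 x : pairing (fun=> 0) x = 0.
Proof. by rewrite /pairing fsbig1// => j _; rewrite mul0r. Qed.

Lemma character0 (theta : torus R) : character (fun=> 0) theta = 1.
Proof. by rewrite /character pairing0 cis2pi0. Qed.

(** Reducing a coordinate modulo [1] changes the pairing by an integer. *)
Lemma character_flow k (rho : nat -> R) (t : R) (theta : torus R) :
  Zstar R eta k ->
  character k (flow rho t theta) = cis2pi (t * pairing k rho) * character k theta.
Proof.
move=> /pairing_finite[n hn]; rewrite /character !hn mulr_sumr !cis2pi_sum -big_split.
apply: eq_bigr => j _ /=; rewrite /Defs.frac -cis2piD mulrBr -intrM cis2piB_int.
by congr cis2pi; ring.
Qed.

Lemma frac_val (c : circle R) : Defs.frac (val c) = val c.
Proof.
case: c => x /= /andP[x0 x1]; rewrite /Defs.frac.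
suff -> : Num.floor x = 0 by rewrite subr0.
by apply: floor_def; rewrite add0r x0.
Qed.

Lemma frac_fracD (x y : R) : Defs.frac (Defs.frac x + y) = Defs.frac (x + y).
Proof.
have shift (z : R) (n : int) : Defs.frac (- n%:~R + z) = Defs.frac z.
  rewrite /Defs.frac -mulrNz floorDzr ?intr_int// intrKfloor intrD; ring.
by rewrite {2}/Defs.frac addrAC addrC shift.
Qed.

Lemma iter_rotation (rho : nat -> R) (theta : torus R) (n : nat) :
  iter n (rotation rho) theta = flow rho n%:R theta.
Proof.
elim: n => [|n IH].
  apply: funext => j; apply: val_inj.
  by rewrite /= mulr0 addr0 frac_val.
rewrite iterS IH; apply: funext => j; apply: val_inj => /=.
by rewrite frac_fracD -addrA -natr1 mulrDr mulr1.
Qed.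

End Frequencies.

(** * Absolutely convergent exponential series *)

#[local] Existing Instance totally_filter.

Section ExponentialSeries.
Context {R : realType} {B : normedModType R[i]} {I : choiceType}.
Variables (k0 : I) (kappa : I -> R) (u : I -> B) (F : R -> B).
Hypothesis hF : forall t, partial_sum (fun k => cis2pi (t * kappa k) *: u k) @ totally --> F t.
Hypothesis kappa0 : kappa k0 = 0.
Variables (M S : R) (s : I -> R).
Hypotheses (M0 : 0 <= M) (s0 : forall k, 0 <= s k).
Hypothesis us : forall k, k != k0 -> rnorm (u k) <= M * s k.
Hypothesis sS : forall r : seq I, uniq r -> \sum_(k <- r | k != k0) s k <= S.

Lemma exp_comb_cvg (n : nat) (c : nat -> R[i]) (t : nat -> R) :
  partial_sum (fun k => (\sum_(0 <= j < n) c j * cis2pi (t j * kappa k)) *: u k) @ totally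
    --> \sum_(0 <= j < n) c j *: F (t j).
Proof.
elim: n => [|n IH].
  rewrite big_geq// (_ : partial_sum _ = fun=> 0); first exact: cvg_cst.
  apply: funext => A; rewrite /partial_sum big1// => k _.
  by rewrite big_geq// scale0r.
rewrite big_nat_recr//=.
rewrite (_ : partial_sum _ = fun A =>
    partial_sum (fun k => (\sum_(0 <= j < n) c j * cis2pi (t j * kappa k)) *: u k) A +
    c n *: partial_sum (fun k => cis2pi (t n * kappa k) *: u k) A); last first.
  apply: funext => A; rewrite /partial_sum scaler_sumr -big_split.
  by apply: eq_bigr => k _; rewrite big_nat_recr//= scalerDl scalerA.
by apply: cvgD => //; apply: cvgZl_tmp; exact: hF.
Qed.

(** Finite linear combinations of values of an absolutely convergent exponential
    series, compared with its constant term: the multipliers of the frequencies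
    satisfying [P] are estimated by [b1], the others only by the crude [b2], which
    costs no more than the tail [e] of the dominating series. *)
Lemma exp_comb_bound (P : pred I) (b1 b2 e : R) (n : nat) (c : nat -> R[i]) (t : nat -> R) :
  0 <= b1 -> 0 <= b2 ->
  (forall k, k != k0 -> P k ->
     cabs (\sum_(0 <= j < n) c j * cis2pi (t j * kappa k)) * rnorm (u k) <= b1 * s k) ->
  (forall k, k != k0 -> ~~ P k ->
     cabs (\sum_(0 <= j < n) c j * cis2pi (t j * kappa k)) <= b2) ->
  (forall r : seq I, uniq r -> \sum_(k <- r | (k != k0) && ~~ P k) s k <= e) ->
  rnorm (\sum_(0 <= j < n) c j *: F (t j) - (\sum_(0 <= j < n) c j) *: u k0)
    <= b1 * S + b2 * (M * e).
Proof.
move=> b10 b20 h1 h2 he; pose m k := \sum_(0 <= j < n) c j * cis2pi (t j * kappa k).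
have mk0 : m k0 = \sum_(0 <= j < n) c j.
  by apply: eq_bigr => j _; rewrite kappa0 mulr0 cis2pi0 mulr1.
apply/ler_addgt0Pr => d d0.
have Fk0 : totally [set A : {fset I} | [fset k0]%fset `<=` A]%fset by exists [fset k0]%fset.
have := (@cvg_rnormP _ _ _ _ totally_filter _ _).1 (@exp_comb_cvg n c t) d d0.
move=> /(filterI Fk0)/filter_ex[A [/= kA hA]].
set l := \sum_(0 <= j < n) c j *: F (t j) in hA *.
rewrite -(subrK (partial_sum (fun k => m k *: u k) A) l) -addrA.
rewrite [leRHS]addrC (le_trans (ler_rnormD _ _))// lerD//.
have k0A : k0 \in A by apply: (fsubsetP kA); rewrite inE.
have -> : partial_sum (fun k => m k *: u k) A - (\sum_(0 <= j < n) c j) *: u k0 =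
    \sum_(k <- A | k != k0) m k *: u k.
  rewrite /partial_sum -(big_seq_fsetE _ A predT (fun k => m k *: u k))/=.
  by rewrite (bigD1_seq k0)//= mk0 addrAC subrr add0r.
apply: (le_trans (ler_rnorm_sum _ _ _)).
apply: (@le_trans _ _ (\sum_(k <- A | k != k0)
    (b1 * s k + (if P k then 0 else b2 * (M * s k))))).
  apply: ler_sum => k kk0; rewrite rnormZ; case: ifPn => Pk.
    by rewrite addr0; exact: h1.
  apply: (@le_trans _ _ (b2 * (M * s k))); last by rewrite lerDr mulr_ge0.
  by apply: ler_pM; [exact: cabs_ge0|exact: rnorm_ge0|exact: h2|exact: us].
rewrite big_split/= -mulr_sumr lerD//; first by rewrite ler_wpM2l// sS.
rewrite (eq_bigr (fun k => b2 * (M * (if P k then 0 else s k)))); last first.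
  by move=> k _; case: ifP => _; rewrite ?mulr0.
rewrite -!mulr_sumr !ler_wpM2l//.
rewrite (eq_bigr (fun k => if ~~ P k then s k else 0)); last by move=> k _; case: (P k).
by rewrite -big_mkcondr he.
Qed.

(** A finite set whose partial sum is within [e] of the supremum leaves at most [e]
    to any disjoint finite set. *)
Lemma series_tail (e : R) : 0 < e -> exists A : seq I, forall r : seq I, uniq r ->
  \sum_(k <- r | (k != k0) && (k \notin A)) s k <= e.
Proof.
move=> e0; pose E := [set x | exists2 r : seq I, uniq r & x = \sum_(k <- r | k != k0) s k].
have hE : has_sup E.
  split; first by exists 0; exists [::] => //; rewrite big_nil.
  by exists S => _ [r ur ->]; exact: sS.
have [_ [A uA ->] hA] := sup_adherent e0 hE.
exists A => r ur; pose q := [seq k <- r | k \notin A].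
have uq : uniq (A ++ q).
  rewrite cat_uniq uA filter_uniq//= andbT; apply/hasPn => k.
  by rewrite mem_filter => /andP[].
have : \sum_(k <- A ++ q | k != k0) s k <= sup E.
  by apply: ub_le_sup; [exact: hE.2|exists (A ++ q)].
rewrite big_cat/= big_filter_cond (eq_bigl _ _ (fun k => andbC _ _)) => h.
lra.
Qed.

Lemma bounded_on_seq (A : seq I) : exists2 K : R, 0 <= K &
  forall k, k \in A -> `|kappa k| <= K.
Proof.
exists (\sum_(k <- A) `|kappa k|) => [|k]; first exact: sumr_ge0.
elim: A => // a A IH; rewrite inE big_cons => /predU1P[->|/IH h].
  by rewrite lerDl sumr_ge0.
by rewrite (le_trans h)// lerDr.
Qed.

Let S0 : 0 <= S. Proof. by have := sS (r := [::]) isT; rewrite big_nil. Qed.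

(** A difference of two values is the combination with coefficients [1] and [-1]:
    the constant term cancels, the frequencies in a finite set have multipliers
    that are Lipschitz in the time, and all multipliers are at most [2]. *)
Lemma exp_series_unif_cont (e : R) : 0 < e -> exists2 del : R, 0 < del &
  forall x y : R, `|x - y| <= del -> rnorm (F x - F y) <= e.
Proof.
move=> e0; have d1 : 0 < e / (4 * (M + 1)) by rewrite divr_gt0// mulr_gt0// ltr_wpDl.
have [A hA] := series_tail d1; have [K K0 hK] := bounded_on_seq A.
have [q qE q0] : exists2 q, q = 2 * pi * K * M * S & 0 <= q.
  by eexists; first reflexivity; rewrite !mulr_ge0 ?pi_ge0.
have q1 : 0 < q + 1 by rewrite ltr_wpDl.
have [del delE del0] : exists2 del, del = e / (2 * (q + 1)) & 0 < del.
  by eexists; first reflexivity; rewrite divr_gt0// mulr_gt0.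
exists del => // x y xy.
pose c (j : nat) : R[i] := if j is 0 then 1 else -1.
pose t (j : nat) : R := if j is 0 then x else y.
have E k : \sum_(0 <= j < 2) c j * cis2pi (t j * kappa k) =
    cis2pi (x * kappa k) - cis2pi (y * kappa k).
  by rewrite big_ltn// big_nat1 /= mul1r mulN1r.
have := @exp_comb_bound (mem A) (2 * pi * K * del * M) 2 _ 2 c t _ _ _ _ hA.
have -> : \sum_(0 <= j < 2) c j *: F (t j) = F x - F y.
  by rewrite big_ltn// big_nat1 /= scale1r scaleN1r.
have -> : \sum_(0 <= j < 2) c j = 0.
  by rewrite big_ltn// big_nat1 /= subrr.
rewrite scale0r subr0 => h; apply: (le_trans (h _ _ _ _)) => //.
- by rewrite !mulr_ge0 ?pi_ge0 ?(ltW del0).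
- move=> k kk0 kA; rewrite E -mulrA; apply: ler_pM => //; [exact: cabs_ge0|exact: rnorm_ge0| |exact: us].
  rewrite (le_trans (cabsB_cis2pi_le _ _))// -mulrBl normrM -!mulrA !ler_wpM2l ?pi_ge0//.
  by rewrite mulrC ler_pM// hK.
- move=> k _ _; rewrite E -lecR -normC_cabs (le_trans (ler_normB _ _))//.
  by rewrite !normC_cabs !cabs_cis2pi -rmorphD.
have -> : 2 * (M * (e / (4 * (M + 1)))) = e / 2 * (M / (M + 1)).
  by field; apply/lt0r_neq0; rewrite ltr_wpDl.
have h1 : e / 2 * (M / (M + 1)) <= e / 2.
  rewrite ler_piMr// ?ler_pdivrMr ?mul1r ?lerDl ?ltr_wpDl//.
  by rewrite divr_ge0 // ltW.
have h2 : 2 * pi * K * del * M * S <= e / 2.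
  rewrite (_ : _ * S = del * q); last by rewrite qE; ring.
  rewrite (_ : del * q = e / 2 * (q / (q + 1))); last first.
    by rewrite delE; field; rewrite gt_eqF.
  rewrite ler_piMr// ?ler_pdivrMr ?mul1r ?lerDl//.
  by rewrite divr_ge0 // ltW.
lra.
Qed.

Lemma exp_series_bounded (x : R) : rnorm (F x) <= rnorm (u k0) + M * S.
Proof.
have := @exp_comb_bound predT M 0 0 1 (fun=> 1) (fun=> x) M0 (lexx 0).
rewrite !big_nat1 scale1r mul0r addr0 scale1r => h.
rewrite -[F x](subrK (u k0)) addrC (le_trans (ler_rnormD _ _))// lerD2l h//.
- move=> k kk0 _; rewrite big_nat1 mul1r cabs_cis2pi mul1r; exact: us.
- by move=> r _; rewrite big_pred0// => k; rewrite andbF.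
Qed.

End ExponentialSeries.

(** * Constants of the estimates *)

Section Constants.
Context {R : realType}.

Lemma mul_div_succ_le (x e : R) : 0 <= x -> 0 <= e -> x * (e / (x + 1)) <= e.
Proof.
move=> x0 e0; rewrite mulrCA ler_piMr// ler_pdivrMr ?ltr_wpDl// mul1r.
by rewrite lerDl.
Qed.

Lemma ereal_sup_lty_bound {T : Type} (D : set T) (a : T -> R) :
  (ereal_sup [set (a k)%:E | k in D] < +oo)%E ->
  exists2 M : R, 0 <= M & forall k, D k -> a k <= M.
Proof.
set l := ereal_sup _ => lty.
have ub k : D k -> ((a k)%:E <= l)%E by move=> Dk; apply: ereal_sup_ubound; exists k.
case: l lty ub => [r _ ub|//|_ ub].
- by exists `|r| => // k /ub; rewrite lee_fin => /le_trans; apply; exact: ler_norm.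
- by exists 0 => // k /ub; rewrite leeNy_eq.
Qed.

Lemma esum_lty_bound {T : choiceType} (D : set T) (a : T -> R) :
  (\esum_(k in D) (a k)%:E < +oo)%E ->
  exists S : R, forall r : seq T, uniq r -> (forall k, k \in r -> D k) ->
    \sum_(k <- r) a k <= S.
Proof.
set l := esum _ _ => lty.
have ub r : uniq r -> (forall k, k \in r -> D k) -> ((\sum_(k <- r) a k)%:E <= l)%E.
  move=> ur rD; rewrite -sumEFin fsbig_seq//; apply: ereal_sup_ubound.
  by exists [set` r].
case: l lty ub => [S _ ub|//|_ ub].
- by exists S => r ur rD; rewrite -lee_fin ub.
- by exists 0 => r ur /(ub _ ur); rewrite leeNy_eq.
Qed.

End Constants.

Lemma scaler_realC {R : realType} {B : normedModType R[i]} (a b : R) (v : B) :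
  a%:C *: (b%:C *: v) = (a * b)%:C *: v.
Proof. by rewrite scalerA rmorphM. Qed.

Section WeightNormalization.
Context {R : realType} (m : nat) (w : R -> R).
Hypotheses (hw : weighting_function m w) (m0 : (0 < m)%N).

Lemma WB_norm_cvg : n.+1%:R^-1 * WB_norm w n.+1 @[n --> \oo] --> (1 : R).
Proof.
have [C C0 wC] := weight_lipschitz hw m0.
have [_ _ w1] := hw; rewrite -[X in _ --> X]w1.
exact: (riemann_sum_cvg C0 (weight_ge0 hw) wC).
Qed.

Lemma WB_norm_gt0 N : (2 <= N)%N -> 0 < WB_norm w N.
Proof.
move=> N2; have [_ wpos _] := hw.
rewrite /WB_norm (bigD1_seq 1%N) ?mem_index_iota ?iota_uniq//=.
have N0 : 0 < N%:R :> R by rewrite ltr0n (ltn_trans _ N2).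
rewrite ltr_pwDl//.
  apply: wpos; rewrite in_itv/= divr_gt0//=.
  by rewrite ltr_pdivrMr// mul1r ltr1n.
rewrite big_seq_cond sumr_ge0// => n; rewrite mem_index_iota => /andP[nN _].
by apply: (weight_ge0 hw); rewrite ratio_in01// ltnW.
Qed.

(** The sequence [N / A_N] converges, and [A_N] is positive from [N = 2] on, where
    the interior point [1 / N] is sampled. *)
Lemma WB_norm_lower : exists2 K : R, 0 <= K &
  forall N, (2 <= N)%N -> N%:R / WB_norm w N <= K.
Proof.
have c1 : (n.+1%:R^-1 * WB_norm w n.+1)^-1 @[n --> \oo] --> (1 : R).
  by rewrite -[X in _ --> X]invr1; apply: cvgV; [exact: oner_neq0|exact: WB_norm_cvg].
have /cvg_seq_bounded : cvgn (fun n => (n.+1%:R^-1 * WB_norm w n.+1)^-1 : R^o).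
  by apply/cvg_ex; exists 1.
move=> /pinfty_ex_gt0[K K0 hK]; exists K; first exact: ltW.
move=> [|N] // N2; apply: le_trans (hK N Logic.I).
by rewrite invfM invrK ler_norm.
Qed.

(** The estimate of the exponential sums in terms of a small divisor. The scale
    [tau] is [N] for sums over the integers and [T] for Riemann sums of a time
    integral, whose phase is [T / N] times the frequency. *)
Lemma weight_sum_small_divisor : exists2 C : R, 0 <= C &
  forall (N : nat) (a tau gamma del : R), (0 < N)%N -> 0 < tau -> 0 < gamma -> 0 < del ->
    2 * (gamma * tau / (del * N%:R)) <= cabs (1 - cis2pi a) ->
    cabs (weight_sum w N a) <= N%:R * (C / tau ^+ m / gamma ^+ m * del ^+ m).
Proof.
have [C C0 hC] := weight_sum_bound hw.
exists ((1 + m%:R) * C / 2 ^+ m); first by rewrite divr_ge0 ?mulr_ge0 ?addr_ge0 ?exprn_ge0.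
move=> N a tau gamma del N0 t0 g0 d0 h.
have Npos : 0 < N%:R :> R by rewrite ltr0n.
set q := 2 * _ in h.
have q0 : 0 < q by rewrite !mulr_gt0// invr_gt0 mulr_gt0.
have := hC N a N0.
have : cabs (weight_sum w N a) * q ^+ m <= cabs (weight_sum w N a) * cabs (1 - cis2pi a) ^+ m.
  by rewrite ler_wpM2l ?cabs_ge0// lerXn2r// nnegrE ?cabs_ge0// ltW.
move=> /le_trans /[apply]; rewrite -ler_pdivlMr ?exprn_gt0// => /le_trans; apply.
rewrite le_eqVlt; apply/orP; left; apply/eqP.
rewrite /q !exprMn exprVn exprMn; field.
by rewrite !expf_neq0 ?gt_eqF.
Qed.

End WeightNormalization.

(** * Convergence of the weighted averages *)

Section Averages.
Context {R : realType} {B : completeNormedModType R[i]}.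
Variables (mu : probability (torus R) R) (eta m : nat) (w d Delta : R -> R) (gamma : R).
Hypotheses (hm : (0 < m)%N) (hw : weighting_function m w).
Hypotheses (hd : approximation_function d) (hDelta : approximation_function Delta).
Hypothesis hgamma : 0 < gamma.
Variable f : torus R -> B.
Hypothesis hf : in_BDelta mu eta Delta f.
Hypothesis hsum : (\esum_(k in Zstar_neq0 R eta)
  (d (eta_norm eta k) ^+ m / Delta (eta_norm eta k))%:E < +oo)%E.

Definition zero_mode : Zstar R eta := exist _ (fun=> 0) (mem_set (Zstar_0 eta)).

Local Notation k0 := zero_mode.

Let neq0P (k : Zstar R eta) : k != k0 -> Zstar_neq0 R eta (val k).
Proof.
move=> kk0; split; first exact: set_valP.
by move=> /= k0E; case/eqP: kk0; apply: val_inj.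
Qed.

(** The absolute value only affects [zero_mode], whose norm lies outside the domain
    of the approximation functions. *)
Definition divisor_weight (k : Zstar R eta) : R :=
  `|d (eta_norm eta (val k)) ^+ m / Delta (eta_norm eta (val k))|.

Local Notation s := divisor_weight.

Let d_ge1 (k : Zstar R eta) : k != k0 -> 1 <= d (eta_norm eta (val k)).
Proof.
move=> /neq0P/eta_norm_ge1 h; have [_ _ d1 _] := hd.
by apply: d1; rewrite in_itv/= h.
Qed.

Let Delta_ge1 (k : Zstar R eta) : k != k0 -> 1 <= Delta (eta_norm eta (val k)).
Proof.
move=> /neq0P/eta_norm_ge1 h; have [_ _ d1 _] := hDelta.
by apply: d1; rewrite in_itv/= h.
Qed.

Let sE k : k != k0 -> s k = d (eta_norm eta (val k)) ^+ m / Delta (eta_norm eta (val k)).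
Proof.
move=> kk0; rewrite /divisor_weight ger0_norm// divr_ge0 ?exprn_ge0//.
  by rewrite (le_trans ler01)// d_ge1.
by rewrite (le_trans ler01)// Delta_ge1.
Qed.

Lemma small_divisor_sum_bounded : exists S : R, forall r : seq (Zstar R eta), uniq r ->
  \sum_(k <- r | k != k0) s k <= S.
Proof.
have [S hS] := esum_lty_bound hsum; exists S => r ur.
have := hS [seq val k | k <- r & k != k0].
rewrite (map_inj_uniq val_inj) filter_uniq//.
rewrite big_map big_filter => /(_ isT) h.
rewrite (eq_bigr _ (fun k kk0 => sE kk0)) h// => k /mapP[k' + ->].
by rewrite mem_filter => /andP[/neq0P].
Qed.

Lemma fourier_coef_bounded : exists2 M : R, 0 <= M & forall k : Zstar R eta, k != k0 ->
  rnorm (fourier_coef mu f (val k)) <= M / Delta (eta_norm eta (val k)).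
Proof.
have [_ _ /ereal_sup_lty_bound[M M0 hM]] := hf.
exists M => // k kk0; rewrite ler_pdivlMr ?(lt_le_trans ltr01 (Delta_ge1 kk0))//.
by rewrite mulrC hM//; exact: neq0P.
Qed.

Lemma fourier_coef0 : fourier_coef mu f (fun=> 0) = torus_integral mu f.
Proof.
rewrite /fourier_coef; congr torus_integral; apply: funext => theta.
by rewrite oppr0 character0 scale1r.
Qed.

Section Orbit.
Variables (rho : nat -> R) (theta : torus R).

Let kappa (k : Zstar R eta) : R := pairing (val k) rho.
Let u (k : Zstar R eta) : B := character (val k) theta *: fourier_coef mu f (val k).
Let F (t : R) : B := f (flow rho t theta).

Lemma flow_series t :
  partial_sum (fun k => cis2pi (t * kappa k) *: u k) @ totally --> F t.
Proof.
have [_ /(_ (flow rho t theta)) h _] := hf; move: h.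
rewrite (_ : (fun k : Zstar R eta => _) = (fun k => cis2pi (t * kappa k) *: u k))//.
apply: funext => k; rewrite (character_flow _ _ _ (set_valP k)).
by rewrite /u scalerA.
Qed.

Let kappa0 : kappa k0 = 0. Proof. exact: pairing0. Qed.

Let u0 : u k0 = torus_integral mu f.
Proof. by rewrite /u character0 scale1r fourier_coef0. Qed.

Let rnorm_u k : rnorm (u k) = rnorm (fourier_coef mu f (val k)).
Proof. by rewrite /u rnormZ cabs_cis2pi mul1r. Qed.

Variables (M S : R).
Hypotheses (M0 : 0 <= M) (hM : forall k : Zstar R eta, k != k0 ->
  rnorm (fourier_coef mu f (val k)) <= M / Delta (eta_norm eta (val k))).
Hypothesis hS : forall r : seq (Zstar R eta), uniq r -> \sum_(k <- r | k != k0) s k <= S.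

Let us k : k != k0 -> rnorm (u k) <= M * s k.
Proof.
move=> kk0; rewrite rnorm_u (le_trans (hM kk0))// sE// mulrA.
rewrite ler_wpM2r ?invr_ge0 ?(le_trans ler01 (Delta_ge1 kk0))// ler_peMr//.
by rewrite exprn_ege1// d_ge1.
Qed.

Let s0 k : 0 <= s k. Proof. exact: normr_ge0. Qed.

(** The factor [d ^+ m] lost to the small divisor is recovered from the decay of
    the Fourier coefficient. *)
Let multiplier_le (X x : R) k : 0 <= X -> k != k0 ->
  x <= X * d (eta_norm eta (val k)) ^+ m -> x * rnorm (u k) <= X * M * s k.
Proof.
move=> X0 kk0 xX; rewrite sE//.
have -> : X * M * (d (eta_norm eta (val k)) ^+ m / Delta (eta_norm eta (val k))) =
  X * d (eta_norm eta (val k)) ^+ m * (M / Delta (eta_norm eta (val k))) by ring.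
apply: (@le_trans _ _ (X * d (eta_norm eta (val k)) ^+ m * rnorm (u k))).
  by rewrite ler_wpM2r// rnorm_ge0.
rewrite rnorm_u ler_wpM2l ?hM// mulr_ge0// exprn_ge0//.
by rewrite (le_trans ler01)// d_ge1.
Qed.

Variables (C K : R).
Hypotheses (C0 : 0 <= C) (hC : forall (N : nat) (a tau gamma del : R),
    (0 < N)%N -> 0 < tau -> 0 < gamma -> 0 < del ->
    2 * (gamma * tau / (del * N%:R)) <= cabs (1 - cis2pi a) ->
    cabs (weight_sum w N a) <= N%:R * (C / tau ^+ m / gamma ^+ m * del ^+ m)).
Hypothesis (hK : forall N, (2 <= N)%N -> N%:R / WB_norm w N <= K).

(** The multiplier of [k] is [weight_sum w N (k . rho)], so that the small divisor
    estimate applies to all frequencies with [tau = N]. *)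
Lemma WB_convergence N : nonresonant_discrete eta gamma d rho -> (2 <= N)%N ->
  rnorm (WB w rho f theta N - torus_integral mu f)
    <= K * (C / gamma ^+ m * M * S) / N%:R ^+ m.
Proof.
move=> hnr N2; have N0 : (0 < N)%N by exact: ltn_trans N2.
have Npos : 0 < N%:R :> R by rewrite ltr0n.
have A0 := WB_norm_gt0 hw N2.
pose c n : R[i] := (w (n%:R / N%:R))%:C.
have -> : WB w rho f theta N - torus_integral mu f = ((WB_norm w N)^-1)%:C *:
    (\sum_(0 <= n < N) c n *: F n%:R - (\sum_(0 <= n < N) c n) *: u k0).
  rewrite scalerBr scalerA /c -rmorph_sum -rmorphM/= mulVf ?gt_eqF// scale1r u0.
  congr (_ *: _ - _); apply: eq_bigr => n _.
  by rewrite iter_rotation.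
rewrite rnormZ cabs_real ger0_norm ?invr_ge0 ?(ltW A0)//.
have [X XE X0] : exists2 X, X = C / N%:R ^+ m / gamma ^+ m & 0 <= X.
  by eexists; first reflexivity; rewrite !divr_ge0 ?exprn_ge0// ltW.
have H : rnorm (\sum_(0 <= n < N) c n *: F n%:R - (\sum_(0 <= n < N) c n) *: u k0)
    <= N%:R * X * M * S + 0 * (M * 0).
  apply: (@exp_comb_bound _ _ _ k0 kappa u F flow_series kappa0 M S s M0 s0 us hS predT
    (N%:R * X * M) 0 0 N c (fun n => n%:R)) => //.
  - by rewrite !mulr_ge0.
  - move=> k kk0 _; apply: multiplier_le => //; first by rewrite mulr_ge0.
    rewrite XE -[leRHS]mulrA; apply: hC => //; first by rewrite (lt_le_trans ltr01)// d_ge1.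
    apply: cabs_1B_cis2pi_dist => n; rewrite invfM mulrA mulrAC mulfK ?gt_eqF//.
    exact/ltW/hnr/neq0P.
  - by move=> r _; rewrite big_pred0// => k; rewrite andbF.
apply: (le_trans (ler_wpM2l _ H)); first by rewrite invr_ge0 ltW.
rewrite mul0r addr0.
have -> : (WB_norm w N)^-1 * (N%:R * X * M * S) = N%:R / WB_norm w N * (X * M * S) by ring.
have -> : K * (C / gamma ^+ m * M * S) / N%:R ^+ m = K * (X * M * S).
  by rewrite XE; field; rewrite !expf_neq0 ?gt_eqF.
rewrite ler_wpM2r ?hK// !mulr_ge0//.
by have := hS (r := [::]) isT; rewrite big_nil.
Qed.

(** The bound passes to the limit from the Riemann sums with [n.+1] nodes. On a
    finite set of frequencies the small divisor estimate applies with [tau = T] as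
    soon as [T / n.+1] times the frequency is at most [1 / 2]; the other
    frequencies are bounded by the supremum of [w] times a tail. *)
Lemma WB_cont_convergence (T : R) : nonresonant_continuous eta gamma d rho -> 1 <= T ->
  rnorm (WB_cont w rho f theta T - torus_integral mu f)
    <= (C / gamma ^+ m * M * S) / T ^+ m.
Proof.
move=> hnr T1; have T0 : 0 < T by rewrite (lt_le_trans ltr01).
have [Cw Cw0 hCw] := weight_bounded hw.
have [Lw Lw0 hLw] := weight_lipschitz hw hm.
have S0 : 0 <= S by have := hS (r := [::]) isT; rewrite big_nil.
have Texp (t : R) : t \in `[0, T] -> t / T \in `[0, 1].
  rewrite !in_itv/= => /andP[t0 tT]; rewrite divr_ge0 ?(ltW T0)//=.
  by rewrite ler_pdivrMr// mul1r.
pose g (t : R) : B := (w (t / T))%:C *: F t.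
have ucg (e : R) : 0 < e -> exists2 del : R, 0 < del & forall x y : R,
     x \in `[0, T] -> y \in `[0, T] -> `|x - y| <= del -> rnorm (g x - g y) <= e.
  move=> e0.
  have e1 : 0 < e / 2 / (Cw + 1) by rewrite !divr_gt0// ltr_wpDl.
  have [del del0 hdel] := exp_series_unif_cont flow_series kappa0 M0 s0 us hS e1.
  set Q := rnorm (u k0) + M * S.
  have Q0 : 0 <= Q by rewrite addr_ge0 ?rnorm_ge0// mulr_ge0.
  have D0 : 0 < Lw * Q + 1 by rewrite ltr_wpDl// mulr_ge0.
  exists (Num.min del (e / 2 / (Lw * Q + 1))).
    by rewrite lt_min del0 !divr_gt0.
  move=> x y xI yI; rewrite le_min => /andP[xy1 xy2].
  have -> : g x - g y = (w (x / T) - w (y / T))%:C *: F x + (w (y / T))%:C *: (F x - F y).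
    by rewrite /g rmorphB/= scalerBl scalerBr addrA subrK.
  rewrite (le_trans (ler_rnormD _ _))// !rnormZ !cabs_real [leRHS]splitr lerD//.
    have FQ : rnorm (F x) <= Q by exact: (exp_series_bounded flow_series kappa0 M0 s0 us hS).
    apply: (@le_trans _ _ (Lw * `|x - y| * Q)).
      rewrite ler_pM ?rnorm_ge0// (le_trans (hLw _ _ (Texp _ xI) (Texp _ yI)))//.
      rewrite ler_wpM2l// -mulrBl normrM -[leRHS]mulr1 ler_wpM2l//.
      by rewrite normfV gtr0_norm// invf_le1.
    rewrite mulrAC; apply: (@le_trans _ _ ((Lw * Q) * (e / 2 / (Lw * Q + 1)))).
      by rewrite ler_wpM2l// mulr_ge0.
    by apply: mul_div_succ_le; [exact: mulr_ge0|rewrite divr_ge0// ltW].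
  apply: (@le_trans _ _ (Cw * (e / 2 / (Cw + 1)))).
    by rewrite ler_pM ?rnorm_ge0 ?hCw ?Texp// hdel.
  by apply: mul_div_succ_le; rewrite ?divr_ge0// ltW.
pose W n : R := n.+1%:R^-1 * WB_norm w n.+1.
pose c n j : R[i] := (w (j%:R / n.+1%:R))%:C.
pose Rn n : B := \sum_(0 <= j < n.+1) c n j *: F (step_point T n j).
have RnE n : (n.+1%:R^-1)%:C *: Rn n = (T^-1)%:C *:
    ((T / n.+1%:R)%:C *: \sum_(0 <= j < n.+1) g (step_point T n j)).
  rewrite scaler_realC mulrA mulVf ?gt_eqF// mul1r; congr (_ *: _).
  apply: eq_bigr => j _; rewrite /g /c /step_point; congr ((w _)%:C *: _).
  by field; rewrite gt_eqF//= natr1 pnatr_eq0.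
have c1 : (n.+1%:R^-1)%:C *: Rn n @[n --> \oo] --> WB_cont w rho f theta T.
  under eq_fun do rewrite RnE.
  exact: cvgZl_tmp (bochner_integral_riemann T0 ucg).
have c2 : rnorm ((n.+1%:R^-1)%:C *: Rn n - (W n)%:C *: u k0) @[n --> \oo]
    --> rnorm (WB_cont w rho f theta T - u k0).
  apply: cvg_rnorm; apply: cvgB => //.
  apply/cvg_rnormP => e e0.
  have e1 : 0 < e / (rnorm (u k0) + 1) by rewrite divr_gt0// ltr_wpDl// rnorm_ge0.
  have /cvgrPdist_le/(_ _ e1) := WB_norm_cvg hw hm; apply: filterS => n hn.
  rewrite -[X in X - _]scale1r -scalerBl -[1]/(1%:C) -rmorphB rnormZ cabs_real.
  apply: (le_trans (ler_wpM2r (rnorm_ge0 _) hn)).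
  by rewrite mulrC; apply: mul_div_succ_le; [exact: rnorm_ge0|exact: ltW].
rewrite -u0.
have [X XE X0] : exists2 X, X = C / T ^+ m / gamma ^+ m & 0 <= X.
  by eexists; first reflexivity; rewrite !divr_ge0 ?exprn_ge0// ltW.
have -> : C / gamma ^+ m * M * S / T ^+ m = X * M * S.
  by rewrite XE; field; rewrite !expf_neq0 ?gt_eqF.
apply/ler_addgt0Pr => e e0.
have e1 : 0 < e / ((Cw + 1) * (M + 1)) by rewrite divr_gt0// mulr_gt0// ltr_wpDl.
(* A is the finite set of frequencies on which the small divisors are used. *)
have [A hA] := series_tail hS e1.
have [Kb Kb0 hKb] := bounded_on_seq kappa A.
have c3 : X * M * S + e @[_ --> \oo] --> X * M * S + e by exact: cvg_cst.
apply: (ler_cvg_to c2 c3).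
have Kb1 : 0 < 1 / (2 * (Kb + 1)) by rewrite divr_gt0// mulr_gt0// ltr_wpDl.
have := near_step_lt T0 Kb1; apply: filterS => n hn.
have n0 : 0 < n.+1%:R :> R by [].
have -> : (n.+1%:R^-1)%:C *: Rn n - (W n)%:C *: u k0 =
    (n.+1%:R^-1)%:C *: (Rn n - (\sum_(0 <= j < n.+1) c n j) *: u k0).
  have -> : \sum_(0 <= j < n.+1) c n j = (WB_norm w n.+1)%:C.
    by rewrite /c -rmorph_sum.
  by rewrite scalerBr scaler_realC.
rewrite rnormZ cabs_real ger0_norm ?invr_ge0// ler_pdivrMl//.
have ws k : \sum_(0 <= j < n.+1) c n j * cis2pi (step_point T n j * kappa k) =
    weight_sum w n.+1 (T / n.+1%:R * kappa k).
  by apply: eq_bigr => j _; rewrite /step_point !mulrA.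
have H : rnorm (Rn n - (\sum_(0 <= j < n.+1) c n j) *: u k0)
    <= n.+1%:R * X * M * S + n.+1%:R * Cw * (M * (e / ((Cw + 1) * (M + 1)))).
  apply: (@exp_comb_bound _ _ _ k0 kappa u F flow_series kappa0 M S s M0 s0 us hS (mem A)
    (n.+1%:R * X * M) (n.+1%:R * Cw) _ n.+1 (c n) (step_point T n)) => //.
  - by rewrite !mulr_ge0.
  - by rewrite mulr_ge0.
  - move=> k kk0 kA; rewrite ws; apply: multiplier_le => //; first by rewrite mulr_ge0.
    have dk : 0 < d (eta_norm eta (val k)) by rewrite (lt_le_trans ltr01)// d_ge1.
    rewrite XE -[leRHS]mulrA; apply: hC => //.
    have hk : 2 * `|T / n.+1%:R * kappa k| <= cabs (1 - cis2pi (T / n.+1%:R * kappa k)).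
      apply: cabs_1B_cis2pi_ge; rewrite normrM ger0_norm ?divr_ge0 ?(ltW T0)//.
      apply: (@le_trans _ _ (1 / (2 * (Kb + 1)) * Kb)).
        by rewrite ler_pM ?divr_ge0 ?(ltW T0) ?(ltW hn)// hKb.
      rewrite -mulrA mul1r invfM -mulrA mul1r ler_piMr ?invr_ge0//.
      by rewrite mulrC ler_pdivrMr ?ltr_wpDl// mul1r lerDl.
    apply: (le_trans _ hk); rewrite ler_wpM2l// normrM ger0_norm ?divr_ge0 ?(ltW T0)//.
    have -> : gamma * T / (d (eta_norm eta (val k)) * n.+1%:R) =
        T / n.+1%:R * (gamma / d (eta_norm eta (val k))).
      by field; rewrite gt_eqF//= natr1 pnatr_eq0.
    by rewrite ler_wpM2l ?divr_ge0 ?(ltW T0)//; apply/ltW/hnr/neq0P.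
  - move=> k _ _; rewrite (le_trans (le_cabs_sum _ _ _))//.
    apply: (@le_trans _ _ (\sum_(0 <= j < n.+1) Cw)); last first.
      by rewrite sumr_const_nat subn0 mulr_natl.
    rewrite big_nat [leRHS]big_nat ler_sum// => j /andP[_ jn].
    by rewrite cabsM cabs_cis2pi mulr1 cabs_real hCw// ratio_in01// ltnW.
apply: (le_trans H).
have -> : n.+1%:R * X * M * S + n.+1%:R * Cw * (M * (e / ((Cw + 1) * (M + 1)))) =
  n.+1%:R * (X * M * S + e * (Cw / (Cw + 1) * (M / (M + 1)))).
  by field; rewrite !gt_eqF ?ltr_wpDl.
rewrite ler_pM2l// lerD2l ler_piMr ?(ltW e0)//.
rewrite -[leRHS]mul1r ler_pM ?divr_ge0 ?addr_ge0//.
- by rewrite ler_pdivrMr ?ltr_wpDl// mul1r lerDl.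
- by rewrite ler_pdivrMr ?ltr_wpDl// mul1r lerDl.
Qed.

End Orbit.

End Averages.

Theorem theorem2p9 (R : realType) (B : completeNormedModType (complex R))
  (mu : probability (torus R) R) (hmu : is_product_lebesgue mu)
  (eta : nat) (heta : (2 <= eta)%N) (m : nat) (hm : (2 <= m)%N)
  (w : R -> R) (hw : weighting_function m w)
  (d Delta : R -> R) (hd : approximation_function d)
  (hDelta : approximation_function Delta)
  (gamma : R) (hgamma : 0 < gamma)
  (f : torus R -> B) (hf : in_BDelta mu eta Delta f)
  (hsum : (\esum_(k in Zstar_neq0 R eta)
             (d (eta_norm eta k) ^+ m / Delta (eta_norm eta k))%:E < +oo)%E) :
  exists2 C2 : R, 0 < C2 &
    forall (rho : nat -> R) (theta : torus R),
      (forall j, rho j \in `[1, 2]) ->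
      (nonresonant_discrete eta gamma d rho ->
         forall N : nat, (2 <= N)%N ->
           rnorm (WB w rho f theta N - torus_integral mu f)
             <= C2 / N%:R ^+ m) /\
      (nonresonant_continuous eta gamma d rho ->
         forall T : R, 1 <= T ->
           rnorm (WB_cont w rho f theta T - torus_integral mu f)
             <= C2 / T ^+ m).
Proof.
have m0 : (0 < m)%N by exact: ltn_trans hm.
have [S hS] := small_divisor_sum_bounded hd hDelta hsum.
have [M M0 hM] := fourier_coef_bounded hDelta hf.
have [C C0 hC] := weight_sum_small_divisor hw.
have [K K0 hK] := WB_norm_lower hw m0.
have S0 : 0 <= S by have := hS [::] isT; rewrite big_nil.
have Q0 : 0 <= C / gamma ^+ m * M * S.
  by rewrite !mulr_ge0// invr_ge0 exprn_ge0// ltW.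
exists ((K + 1) * (C / gamma ^+ m * M * S) + 1).
  by rewrite ltr_wpDl// mulr_ge0// addr_ge0.
move=> rho theta _; split=> [hnr N N2|hnr T T1].
  apply: (le_trans (WB_convergence hw hd hDelta hgamma hf theta M0 hM hS C0 hC hK hnr N2)).
  rewrite ler_wpM2r ?invr_ge0 ?exprn_ge0//.
  by rewrite mulrDl mul1r -addrA lerDl addr_ge0.
apply: (le_trans (WB_cont_convergence m0 hw hd hDelta hgamma hf theta M0 hM hS C0 hC hnr T1)).
rewrite ler_wpM2r ?invr_ge0 ?exprn_ge0 ?(le_trans ler01 T1)//.
by rewrite mulrDl mul1r addrAC lerDr addr_ge0// mulr_ge0.
Qed.
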